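(* Suppose that $A$ and $B$ are two nonempty subsets of a normed space $(X,\|\cdot\|)$. If at least one of the following conditions holds, then $\operatorname{dist}(A,B)$ is attained, namely there exists at least one best approximation pair (BAP) with respect to $(A,B)$: (i) $A\cap B\neq\emptyset$; (ii) $A-B$ is proximinal with respect to $\{0\}$; equivalently, there is a minimal norm vector in $A-B$, that is, $\inf\{\|u\| : u\in A-B\}$ is attained; (iii) $A$ is weakly sequentially compact and $B$ is closed, convex and norm-locally weakly sequentially compact; (iv) $A$ is compact and $B$ is closed, convex and locally compact; (v) $A$ is weakly sequentially compact and $B$ is convex and proximinal with respect to $A$; (vi) $A$ is compact and $B$ is proximinal with respect to $A$; (vii) $A$ is boundedly compact and $B$ is bounded and proximinal with respect to $A$; (viii) $A$ and $B$ are boundedly compact and one of them is bounded; (ix) $A$ and $B$ are weakly sequentially compact; (x) $A$ and $B$ are compact; (xi) for all closed balls $D$ in $X^2$ about the origin the intersection $D\cap(A\times B)$ is weakly sequentially compact, and either $A\cup B$ is bounded, or it is unbounded and $\lim_{\|(x,y)\|\to\infty,\,(x,y)\in A\times B}\|x-y\|=\infty$; (xii) $X$ is a reflexive Banach space, $A$ and $B$ are weakly sequentially closed, and there is at least one distance minimizing sequence $((a_k,b_k))_{k\in\mathbb{N}}$ in $A\times B$ such that $(a_k)_{k\in\mathbb{N}}$ has a bounded subsequence; (xiii) $X$ is a reflexive Banach space, $A$ is weakly sequentially compact (alternatively, bounded and weakly sequentially closed), and $B$ is weakly sequentially closed; (xiv) $X$ is a reflexive Banach space, $A$ is bounded and weakly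 closed, and $B$ is closed and convex; (xv) $X$ is a reflexive Banach space, both $A$ and $B$ are convex and closed, and $A$ is bounded; (xvi) $X$ is a reflexive Banach space, $A$ and $B$ are weakly sequentially closed, the union $A\cup B$ is unbounded, and $\lim_{\|(x,y)\|\to\infty,\,(x,y)\in A\times B}\|x-y\|=\infty$; (xvii) $X$ is a reflexive Banach space, both $A$ and $B$ are convex and closed, $A\cup B$ is unbounded, and $\lim_{\|(x,y)\|\to\infty,\,(x,y)\in A\times B}\|x-y\|=\infty$; (xviii) $X$ is a reflexive Banach space and $A-B$ is weakly sequentially closed; (xix) $X$ is a reflexive Banach space, $A$ and $B$ are convex, and $A-B$ is closed; (xx) $X$ is a reflexive Banach space, $A=\widetilde{A}+\widehat{A}$ and $B=\widetilde{B}+\widehat{B}$, where both $\widetilde{A}$ and $\widetilde{B}$ are weakly sequentially compact, and $\widehat{A}-\widehat{B}$ is weakly sequentially closed; (xxi) $X$ is a reflexive Banach space, $A$ is a closed affine subspace with a closed linear part $\widetilde{A}$ which is complemented by a closed linear subspace $F$, and $B$ is an affine subspace with a linear part $\widetilde{B}$ such that $\Pi_F(\widetilde{B})$ is closed; (xxii) $X$ is a reflexive Banach space, $A$ is a closed affine subspace, and $B$ is a finite-dimensional affine subspace; (xxiii) $X$ is a reflexive Banach space, $A$ is a closed affine subspace of finite codimension, and $B$ is an affine subspace; (xxiv) $X$ is the dual of a separable Banach space $Y$, $A$ is weak-star sequentially compact, and $B$ is weak-star sequentially closed; (xxv) $X$ is a real Hilbert space and both $A$ and $B$ are polyhedral;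 (xxvi) $X$ is a Hilbert space, $A\subseteq X$ is weakly sequentially closed, $p\in X\setminus A$, and $B$ is the Voronoi cell of $P:=\{p\}$ with respect to $A$, i.e., $B:=\{z\in X : \|z-p\|\le d(z,A)\}$; (xxvii) $X$ is a Hilbert space, $A$ is a closed hyperplane, $p\in X\setminus A$, and $B$ is the full hyperparaboloid induced by $p$ and $A$, that is, the set of all points in $X$ whose distance to $p$ is not greater than their distance to $A$; (xxviii) $X$ is a reflexive Banach space and both $A$ and $B$ are generalized hypercylinders with weakly sequentially compact bases; (xxix) $A$ and $B$ are finite-dimensional affine subspaces; (xxx) $X$ is finite-dimensional, $A$ and $B$ are closed, and either $A\cup B$ is bounded, or $A\cup B$ is unbounded and $\lim_{\|(x,y)\|\to\infty,\,(x,y)\in A\times B}\|x-y\|=\infty$; (xxxi) $X$ is finite-dimensional, $A$ is closed, $\emptyset\neq P\subset X$ is bounded, and $B$ is the Voronoi cell of $P$ with respect to $A$, namely $B:=\{z\in X : d(z,P)\le d(z,A)\}$; (xxxii) $X$ is a finite-dimensional Euclidean space and both $A$ and $B$ are polyhedral.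
   Context: Normed spaces are over $\mathbb{R}$ or $\mathbb{C}$ and $X\neq\{0\}$. For nonempty $A,B\subseteq X$: $\operatorname{dist}(A,B):=\inf\{\|a-b\| : a\in A,\ b\in B\}$, $d(x,B):=\operatorname{dist}(\{x\},B)$, $A+B:=\{a+b: a\in A,b\in B\}$, $A-B:=\{a-b: a\in A,b\in B\}$. A BAP with respect to $(A,B)$ is a pair $(a_0,b_0)\in A\times B$ with $\|a_0-b_0\|=\operatorname{dist}(A,B)$. On $X^2$ the norm is $\|(x,y)\|:=\sqrt{\|x\|^2+\|y\|^2}$. A sequence $((a_k,b_k))_{k\in\mathbb{N}}$ in $A\times B$ is distance minimizing if $\lim_{k\to\infty}\|a_k-b_k\|=\operatorname{dist}(A,B)$. $B$ is proximinal with respect to $A$ if for every $a\in A$ there is $b\in B$ with $d(a,B)=\|a-b\|$. A set $C$ is weakly sequentially closed if weak limits of weakly convergent sequences in $C$ belong to $C$; it is weakly sequentially compact if every sequence in $C$ has a subsequence converging weakly to some point of $C$ (and similarly, for the weak-star topology when $X$ is a dual space, for weak-star sequentially closed/compact). A nonempty $C\subseteq X$ is norm-locally weakly sequentially compact if for every $x\in C$ there is a closed ball $D\subseteq X$ centered at $x$ (of positive radius) such that $D\cap C$ is weakly sequentially compact. $C$ is locally compact if for every $z\in C$ there is a closed ball $D$ of positive radius centered at $z$ such that $D\cap C$ is compact. $C$ is boundedly compact if $D\cap C$ is compact for every closed ball $D$. A set $A$ is an affine subspace if $A=u+\widetilde{A}$ for some $u\in X$ and a linear subspace $\widetilde{A}$,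 called the linear part of $A$; the dimension/codimension of $A$ is that of $\widetilde{A}$. A closed linear subspace $\widetilde{A}$ is (topologically) complemented by a closed linear subspace $F$ if $\widetilde{A}\cap F=\{0\}$ and $\widetilde{A}+F=X$; then $\Pi_F:X\to F$ denotes the linear projection onto $F$ along $\widetilde{A}$ (if $z=z_1+z_2$ with $z_1\in\widetilde{A}$, $z_2\in F$, then $\Pi_F(z)=z_2$). If $F$ can be taken finite-dimensional, $\widetilde{A}$ has finite codimension. A set is polyhedral if it is an intersection of finitely many closed real halfspaces, i.e., it has the form $\bigcap_{i=1}^m\{x\in X : \operatorname{Re} f_i(x)\le\beta_i\}$ with $m\in\mathbb{N}$, $f_i\in X^*$, $\beta_i\in\mathbb{R}$ (it need not be bounded). A real line is an affine set whose linear part is a one-dimensional real linear subspace. A set $A$ is a generalized hypercylinder with base $C$ and axis $L$ if $A=L+(C-c)$, where $C\subseteq X$, $L$ is a real line, and $L\cap C=\{c\}$ for some $c\in X$. *)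

(* Defs.v *)
From HB Require Import structures.
From mathcomp Require Import all_boot all_order all_algebra.
From mathcomp Require Import sesquilinear complex.
From mathcomp Require Import all_classical all_reals all_analysis.

Set Implicit Arguments.
Unset Strict Implicit.
Unset Printing Implicit Defensive.

Import Order.TTheory GRing.Theory Num.Theory.
Import numFieldNormedType.Exports.

Local Open Scope classical_set_scope.
Local Open Scope ring_scope.

(* The scalar field is R or R[i].  A normedModType over R[i] has its norm in
   R[i] (with values on the nonnegative real axis); [rnorm] is that norm read
   in R, so that distances are genuine real numbers. *)

Inductive scalar_kind := RealScalars | ComplexScalars.

Definition scalar_field (R : realType) (s : scalar_kind) : numFieldType :=
  match s with RealScalars => R | ComplexScalars => R[i]%C end.

Definition sre (R : realType) (s : scalar_kind) : scalar_field R s -> R :=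
  match s with RealScalars => fun x => x | ComplexScalars => @complex.Re R end.

Definition sreal (R : realType) (s : scalar_kind) : R -> scalar_field R s :=
  match s with
  | RealScalars => fun x => x
  | ComplexScalars => fun x => (x%:C)%C
  end.

Definition sconj (R : realType) (s : scalar_kind) :
    scalar_field R s -> scalar_field R s :=
  match s with RealScalars => fun x => x | ComplexScalars => @conjc R end.

Arguments sre {R s}.
Arguments sreal {R s}.
Arguments sconj {R s}.

Definition rnorm (R : realType) (s : scalar_kind)
  (V : normedModType (scalar_field R s)) (v : V) : R := sre `|v|.

Section ScalarTheory.
Context {R : realType} {s : scalar_kind}.
Local Notation K := (scalar_field R s).

Lemma srealK : cancel (@sreal R s) sre.
Proof. by case: s. Qed.

Lemma sre_ge0K (x : K) : 0 <= x -> sreal (sre x) = x.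
Proof. by case: s x => //= x /ger0_real; exact: RRe_real. Qed.

Lemma srealD (x y : R) : sreal (x + y) = sreal x + sreal y :> K.
Proof. by case: s => //=; exact: rmorphD. Qed.

Lemma srealM (x y : R) : sreal (x * y) = sreal x * sreal y :> K.
Proof. by case: s => //=; exact: rmorphM. Qed.

Lemma sreal0 : sreal 0 = 0 :> K.
Proof. by case: s. Qed.

Lemma ler_sreal (x y : R) : (sreal x <= sreal y :> K) = (x <= y).
Proof. by case: s => //=; exact: lecR. Qed.

Section Norm.
Context {V : normedModType K}.

Lemma sreal_rnorm (v : V) : sreal (rnorm v) = `|v| :> K.
Proof. exact: sre_ge0K. Qed.

Lemma rnorm_ge0 (v : V) : 0 <= rnorm v.
Proof. by rewrite -ler_sreal sreal_rnorm sreal0. Qed.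

Lemma rnorm0 : rnorm (0 : V) = 0.
Proof. by apply: (can_inj srealK); rewrite sreal_rnorm normr0 sreal0. Qed.

Lemma rnorm0_eq0 (v : V) : rnorm v = 0 -> v = 0.
Proof. by move=> v0; apply: normr0_eq0; rewrite -sreal_rnorm v0 sreal0. Qed.

Lemma ler_rnormD (v w : V) : rnorm (v + w) <= rnorm v + rnorm w.
Proof. by rewrite -ler_sreal srealD !sreal_rnorm ler_normD. Qed.

End Norm.

Lemma rnormZ (V : normedModType K) (a : K) (v : V) :
  rnorm (a *: v) = rnorm (a : K^o) * rnorm v.
Proof.
apply: (can_inj srealK).
by rewrite srealM (sreal_rnorm (a : K^o)) !sreal_rnorm normrZ.
Qed.

Lemma rnorm_sreal (x : R) : 0 <= x -> rnorm (sreal x : K^o) = x.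
Proof.
move=> x0; apply: (can_inj srealK); rewrite sreal_rnorm ger0_norm//.
by rewrite -sreal0 ler_sreal.
Qed.

Lemma sreal1 : sreal 1 = 1 :> K.
Proof. by case: s. Qed.

End ScalarTheory.

Section DualSpace.
Context {R : realType} {s : scalar_kind}.
Local Notation K := (scalar_field R s).
Variable X : normedModType K.

Definition dual_pred : {pred X -> K^o} :=
  fun f => `[< linear f /\ continuous f >].

Record dual_space := DualSpace {
  dual_fun :> X -> K^o ;
  _ : dual_fun \in dual_pred }.

HB.instance Definition _ := [isSub for dual_fun].
HB.instance Definition _ := [Choice of dual_space by <:].

Fact dual_submod_closed : submod_closed dual_pred.
Proof.
split.
  rewrite inE; split; last exact: cst_continuous.
  by move=> a x y /=; rewrite scaler0 addr0.
move=> a f g /asboolP[lf cf] /asboolP[lg cg]; apply/asboolP; split.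
  move=> b x y.
  rewrite -[LHS]/(a *: f (b *: x + y) + g (b *: x + y)).
  rewrite -[RHS]/(b *: (a *: f x + g x) + (a *: f y + g y)).
  rewrite lf lg !scalerDr !scalerA (mulrC a) -!addrA; congr (_ + _).
  by rewrite addrCA.
move=> x; apply: (@continuousD _ K^o) => //; last exact: cg.
exact: (@continuousZl_tmp K K^o X f a x (cf x)).
Qed.

HB.instance Definition _ := GRing.isSubmodClosed.Build K (X -> K^o) dual_pred
  dual_submod_closed.
HB.instance Definition _ := [SubChoice_isSubLmodule of dual_space by <:].

Fact dual_linear (f : dual_space) : linear f.
Proof. by case: f => f /= /asboolP[]. Qed.

HB.instance Definition _ (f : dual_space) :=
  GRing.isLinear.Build K X K^o *:%R (dual_fun f) (dual_linear f).

Fact dual_continuous (f : dual_space) : continuous f.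
Proof. by case: f => f /= /asboolP[]. Qed.

Definition dual_norm (f : dual_space) : R :=
  sup [set rnorm (f x) | x in [set x | rnorm x <= 1]].

Fact dual_has_sup (f : dual_space) :
  has_sup [set rnorm (f x) | x in [set x | rnorm x <= 1]].
Proof.
split; first by exists (rnorm (f 0)), 0 => //=; rewrite rnorm0.
have [k k0 fk] := linear_lipschitz (@dual_continuous f).
exists (sre k) => _ [x /= x1 <-].
rewrite -(@ler_sreal R s) sreal_rnorm sre_ge0K; last exact: ltW.
apply: le_trans (fk x) _; rewrite ler_piMr ?(ltW k0)//.
by rewrite -sreal_rnorm -sreal1 ler_sreal.
Qed.

Fact dual_norm_ub (f : dual_space) (x : X) :
  rnorm x <= 1 -> rnorm (f x) <= dual_norm f.
Proof.
by move=> x1; apply: ub_le_sup; [case: (dual_has_sup f)|exists x].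
Qed.

Fact dual_norm_ge0 (f : dual_space) : 0 <= dual_norm f.
Proof.
have /(dual_norm_ub f) : rnorm (0 : X) <= 1 by rewrite rnorm0.
exact/le_trans/rnorm_ge0.
Qed.

Fact dual_norm_le (f : dual_space) (M : R) :
  (forall x, rnorm x <= 1 -> rnorm (f x) <= M) -> dual_norm f <= M.
Proof.
move=> fM; apply: ge_sup; first by case: (dual_has_sup f).
by move=> _ [x /= x1 <-]; exact: fM.
Qed.

Fact dual_normD (f g : dual_space) :
  sreal (dual_norm (f + g)) <= sreal (dual_norm f) + sreal (dual_norm g) :> K.
Proof.
rewrite -srealD ler_sreal; apply: dual_norm_le => x x1.
rewrite -[(f + g) x]/(f x + g x) (le_trans (ler_rnormD _ _))//.
by rewrite lerD ?dual_norm_ub.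
Qed.

Fact dual_normZ_le (a : K) (f : dual_space) :
  dual_norm (a *: f) <= rnorm (a : K^o) * dual_norm f.
Proof.
apply: dual_norm_le => x x1.
by rewrite -[(a *: f) x]/(a *: f x) rnormZ ler_wpM2l ?rnorm_ge0 ?dual_norm_ub.
Qed.

Fact dual_normZ (a : K) (f : dual_space) :
  sreal (dual_norm (a *: f)) = `|a| * sreal (dual_norm f) :> K.
Proof.
rewrite -(sreal_rnorm (a : K^o)) -srealM; congr sreal; apply/eqP.
rewrite eq_le dual_normZ_le/=.
have [->|a0] := eqVneq a 0.
  by rewrite rnorm0 mul0r dual_norm_ge0.
have ra0 : 0 < rnorm (a : K^o).
  rewrite lt_neqAle rnorm_ge0 andbT eq_sym; apply: contra_neq a0.
  exact: rnorm0_eq0.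
rewrite -{1}[f](scalerK a0) (le_trans (ler_wpM2l _ (dual_normZ_le _ _)))//.
  exact: ltW.
rewrite mulrA -(rnormZ (V := K^o)) -[a *: _]/(a * a^-1) divff//.
by rewrite -sreal1 rnorm_sreal// mul1r.
Qed.

Fact dual_norm_eq0 (f : dual_space) : sreal (dual_norm f) = 0 :> K -> f = 0.
Proof.
rewrite -sreal0 => /(can_inj srealK) f0.
apply/val_inj/funext => x /=.
have [->|x0] := eqVneq x 0; first exact: linear0.
have rx0 : 0 < rnorm x.
  rewrite lt_neqAle rnorm_ge0 andbT eq_sym; apply: contra_neq x0.
  exact: rnorm0_eq0.
apply: rnorm0_eq0; apply/eqP; rewrite eq_le rnorm_ge0 andbT.
have rx1 : rnorm (sreal ((rnorm x)^-1) *: x) <= 1.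
  by rewrite rnormZ rnorm_sreal ?invr_ge0 ?(ltW rx0)// mulVf ?gt_eqF.
have := dual_norm_ub f rx1; rewrite f0 linearZ rnormZ.
by rewrite rnorm_sreal ?invr_ge0 ?(ltW rx0)// pmulr_rle0 ?invr_gt0.
Qed.

HB.instance Definition _ := Lmodule_isNormed.Build K dual_space
  dual_normD dual_normZ dual_norm_eq0.

End DualSpace.

Section Distance.
Context {R : realType} {s : scalar_kind}.
Context {X : normedModType (scalar_field R s)}.
Implicit Types (A B : set X) (x : X) (r : R).

Definition cball x r : set X := closed_ball_ (@rnorm R s X) x r.

Definition dist A B : R := inf [set rnorm (a - b) | a in A & b in B].

Definition pdist x B : R := dist [set x] B.

Definition mink_add A B : set X := [set a + b | a in A & b in B].

Definition mink_sub A B : set X := [set a - b | a in A & b in B].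

Definition best_approx_pair A B (z : X * X) :=
  [/\ A z.1, B z.2 & rnorm (z.1 - z.2) = dist A B].

(* The Euclidean combination of the two norms; the library's norm on [X * X]
   is the equivalent maximum norm. *)
Definition pair_norm (z : X * X) : R :=
  Num.sqrt (rnorm z.1 ^+ 2 + rnorm z.2 ^+ 2).

Definition distance_minimizing A B (u : nat -> X * X) :=
  (forall k, (A `*` B) (u k)) /\
  rnorm ((u k).1 - (u k).2) @[k --> \oo] --> dist A B.

Definition coercive_diff A B :=
  forall M : R, exists N : R, forall z : X * X,
    (A `*` B) z -> N <= pair_norm z -> M <= rnorm (z.1 - z.2).

(* [proximinal B A]: the set B is proximinal with respect to A. *)
Definition proximinal B A :=
  forall a, A a -> exists2 b, B b & pdist a B = rnorm (a - b).

Definition min_norm_attained A :=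
  exists2 u, A u & rnorm u = inf [set rnorm v | v in A].

Definition ball_locally_compact A :=
  forall z, A z -> exists2 r, 0 < r & compact (cball z r `&` A).

Definition boundedly_compact A :=
  forall x r, 0 < r -> compact (cball x r `&` A).

Definition convex A := convex_set (A : set (convex_lmodType X)).

Definition voronoi_cell (P A : set X) : set X :=
  [set z | pdist z P <= pdist z A].

End Distance.

Section WeakTopology.
Context {R : realType} {s : scalar_kind}.
Local Notation K := (scalar_field R s).
Implicit Type X : normedModType K.

Definition weak_cvg X (u : nat -> X) (x : X) :=
  forall f : dual_space X, (f (u k) : K^o) @[k --> \oo] --> (f x : K^o).

Definition weakly_seq_closed X (C : set X) :=
  forall u x, (forall k, C (u k)) -> weak_cvg u x -> C x.

Definition weakly_seq_compact X (C : set X) :=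
  forall u : nat -> X, (forall k, C (u k)) ->
  exists phi : nat -> nat, {homo phi : i j / (i < j)%N} /\
  exists2 x, C x & weak_cvg (u \o phi) x.

Definition locally_weakly_seq_compact X (C : set X) :=
  forall x, C x -> exists2 r, 0 < r & weakly_seq_compact (cball x r `&` C).

Definition weak_space X : topologicalType :=
  sup_topology (fun f : dual_space X =>
    Topological.on (initial_topology (f : X -> K^o))).

Definition weakly_closed X (C : set X) := closed (C : set (weak_space X)).

Definition banach X :=
  forall F : set_system X, ProperFilter F -> cauchy F -> cvg F.

Definition reflexive_banach X :=
  banach X /\
  forall Phi : dual_space (dual_space X),
    exists x : X, forall f : dual_space X, Phi f = f x.

Definition hilbert X :=
  banach X /\
  exists ip : {dot X for @sconj R s}, forall x, `|x| ^+ 2 = ip x x.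

Definition separable X := exists2 D : set X, countable D & dense D.

(* [J] identifies X with the dual of Y; weak-star notions are relative to it. *)
Definition dual_identification X (Y : normedModType K)
    (J : {linear X -> dual_space Y}) :=
  bijective J /\ forall x, `|J x| = `|x|.

Definition weak_star_cvg X (Y : normedModType K) (J : X -> dual_space Y)
    (u : nat -> X) (x : X) :=
  forall y : Y, (J (u k) y : K^o) @[k --> \oo] --> (J x y : K^o).

Definition weak_star_seq_closed X (Y : normedModType K)
    (J : X -> dual_space Y) (C : set X) :=
  forall u x, (forall k, C (u k)) -> weak_star_cvg J u x -> C x.

Definition weak_star_seq_compact X (Y : normedModType K)
    (J : X -> dual_space Y) (C : set X) :=
  forall u : nat -> X, (forall k, C (u k)) ->
  exists phi : nat -> nat, {homo phi : i j / (i < j)%N} /\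
  exists2 x, C x & weak_star_cvg J (u \o phi) x.

End WeakTopology.

Section AffineGeometry.
Context {R : realType} {s : scalar_kind}.
Context {X : normedModType (scalar_field R s)}.
Local Notation K := (scalar_field R s).
Implicit Types (A L F C : set X) (n : nat).

Definition linear_subspace L :=
  L 0 /\ forall (a : K) x y, L x -> L y -> L (a *: x + y).

Definition has_linear_part A L :=
  linear_subspace L /\ exists u, A = mink_add [set u] L.

Definition has_dim L n :=
  exists e : 'I_n -> X,
    (forall c : 'I_n -> K, \sum_i c i *: e i = 0 -> forall i, c i = 0) /\
    L = range (fun c : 'I_n -> K => \sum_i c i *: e i).

Definition finite_dim L := exists n, has_dim L n.

Definition complemented L F :=
  [/\ linear_subspace L /\ closed L, linear_subspace F /\ closed F,
      L `&` F = [set 0] & mink_add L F = setT].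

Definition has_codim L n := exists2 F, complemented L F & has_dim F n.

Definition finite_codim L := exists n, has_codim L n.

(* the projection onto F along L, when F complements L *)
Definition proj_along L F (z : X) : X :=
  xget 0 [set z2 | F z2 /\ exists2 z1, L z1 & z = z1 + z2].

Definition affine_subspace A := exists L, has_linear_part A L.

Definition finite_dim_affine A :=
  exists2 L, has_linear_part A L & finite_dim L.

Definition finite_codim_affine A :=
  exists2 L, has_linear_part A L & finite_codim L.

Definition closed_hyperplane A :=
  closed A /\ exists2 L, has_linear_part A L & has_codim L 1.

Definition polyhedral A :=
  exists m (f : 'I_m -> dual_space X) (beta : 'I_m -> R),
    A = \bigcap_i [set x | sre (f i x) <= beta i].

Definition real_line L :=
  exists u v : X, v != 0 /\ L = range (fun t : R => u + sreal t *: v).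

Definition gen_hypercylinder A C :=
  exists L c, [/\ real_line L, L `&` C = [set c] &
                  A = mink_add L (mink_sub C [set c])].

End AffineGeometry.

(* Main.v *)
(* All linear functionals are taken real-valued: a bounded real-linear functional
   is the real part of a unique dual element, so both kinds of scalars are treated
   at once.  A single separation argument (Hahn-Banach applied to
   [y |-> inf (|y + l (x - c)| - l d)]) gives norming functionals, Mazur's theorem
   and annihilators of closed subspaces.

   In a reflexive space a bounded sequence [u] has a weak limit along every
   ultrafilter, namely the vector representing [f |-> lim f (u k)] on the dual; the
   norming functionals of the rational combinations of [u] tell these limits apart,
   and a subsequence along which countably many functionals converge therefore
   converges weakly.  Hilbert spaces (by Riesz) and duals of separable spaces
   follow the same pattern.

   Given a minimizing sequence [(a k, b k)], the differences [a k - b k] are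
   bounded, hence subconverge weakly to some [w] of norm at most [dist A B], and
   each condition serves to show that [w] lies in [A - B].  For affine sets,
   [A - B] is closed because a closed subspace plus a line is closed, or because the
   projection along a complemented subspace is bounded (Baire); for polyhedral
   sets it is closed by Fourier-Motzkin elimination. *)
Require Import Defs.
From HB Require Import structures.
From mathcomp Require Import all_boot all_order all_algebra.
From mathcomp Require Import sesquilinear complex.
From mathcomp Require Import all_classical all_reals all_analysis.
From mathcomp Require Import ring lra.

Set Implicit Arguments.
Unset Strict Implicit.
Unset Printing Implicit Defensive.

Import Order.TTheory GRing.Theory Num.Theory.
Import numFieldNormedType.Exports.

Local Open Scope classical_set_scope.
Local Open Scope ring_scope.

(** * The Hahn-Banach theorem *)

(** Two obstacles shape the proof. Reflexivity is a statement about the bidual, whereas each case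
    needs a subsequence of a given sequence. Without a separable dual no fixed countable family of
    functionals describes weak convergence, so the family is built from the sequence itself and only
    has to separate its possible limits. Reflexive and Hilbert spaces then enter through one
    property, [bounded_weak_subseq], and share their lemmas. Secondly, often only one of [a k] and
    [b k] is under control. The differences always are, so a limit of [b] is recovered from
    [b = a - (a - b)]. When [B] is proximinal nothing is extracted from [b]: the distance to [B] is
    continuous, and weakly lower semicontinuous if [B] is convex, so a limit of [a] is enough. In
    finite dimension reflexivity is replaced by Bolzano-Weierstrass, applied to one coordinate after
    the other. *)

Section HahnBanach.
Context {R : realType} {V : lmodType R}.
Implicit Types (p q : V -> R) (x y : V).

(** The scaling law is only an inequality at positive [t], which infima satisfy directly; applied to
    [t^-1] it becomes an equality. *)
Definition sublinear p :=
  (forall x y, p (x + y) <= p x + p y) /\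
  (forall t x, 0 < t -> p (t *: x) <= t * p x).

Lemma sublinear0 p : sublinear p -> p 0 = 0.
Proof.
move=> [_ pZ].
have := pZ 2 0; have := pZ 2^-1 0; rewrite !scaler0 invr_gt0 ltr0n.
by move=> /(_ isT) h1 /(_ isT) h2; lra.
Qed.

Lemma sublinearZ p t x : sublinear p -> 0 <= t -> p (t *: x) = t * p x.
Proof.
move=> sp; have [_ pZ] := sp; rewrite le_eqVlt => /orP[/eqP <-|t0].
  by rewrite scale0r mul0r sublinear0.
apply/eqP; rewrite eq_le pZ//=.
have := pZ t^-1 (t *: x); rewrite invr_gt0 => /(_ t0).
by rewrite scalerA mulVf ?gt_eqF// scale1r ler_pdivlMl.
Qed.

Lemma sublinear_geN p x : sublinear p -> - p (- x) <= p x.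
Proof.
by move=> sp; have [/(_ x (- x)) + _] := sp; rewrite subrr sublinear0//; lra.
Qed.

(** The index sets used below are chains, half-lines and weighted points of a convex set. In each of
    them two indices merge into one, which makes the infimum subadditive. *)
Lemma inf_sublinear (I : Type) (i0 : I) (F : I -> V -> R) :
  (forall x, exists m, forall i, m <= F i x) ->
  (forall i j x y, exists k, F k (x + y) <= F i x + F j y) ->
  (forall i t x, 0 < t -> exists k, F k (t *: x) <= t * F i x) ->
  let p x := inf (range (F ^~ x)) in
  sublinear p /\ forall i x, p x <= F i x.
Proof.
move=> Flb FD FZ p.
have pF i x : p x <= F i x.
  have [m mF] := Flb x; apply: ge_inf; last by exists i.
  by exists m => _ [j _ <-].
have p_ge c x : (forall i, c <= F i x) -> c <= p x.
  by move=> cF; apply: lb_le_inf; [exists (F i0 x), i0|move=> _ [j _ <-]].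
split => //; split=> [x y|t x t0].
  rewrite -lerBlDr; apply: (p_ge) => i; rewrite lerBlDr -lerBlDl.
  apply: p_ge => j; rewrite lerBlDl.
  by have [k] := FD i j x y; apply: le_trans; exact: pF.
rewrite -ler_pdivrMl//; apply: p_ge => i; rewrite ler_pdivrMl//.
by have [k] := FZ i t x t0; apply: le_trans; exact: pF.
Qed.

(** Zorn's lemma for the reversed pointwise order: the infimum of a chain is sublinear, and finite
    because every member is at least [- p (- x)]. *)
Lemma minimal_sublinear p : sublinear p ->
  exists q, [/\ sublinear q, forall x, q x <= p x &
    forall r, sublinear r -> (forall x, r x <= q x) -> r = q].
Proof.
move=> sp; pose T := {q : V -> R | sublinear q /\ forall x, q x <= p x}.
pose mkT q qP : T := exist _ q qP.
pose le_T (q r : T) := `[< forall x, sval r x <= sval q x >].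
have [| | |A Atot|[q [sq qp]] qmin] := @Zorn T le_T.
- by move=> q; apply/asboolP.
- move=> q r t /asboolP qr /asboolP rt; apply/asboolP => x.
  exact: le_trans (qr x).
- move=> [q ?] [r ?] /asboolP /= qr /asboolP /= rq; apply: eq_exist; apply/funext => x.
  by apply/eqP; rewrite eq_le qr rq.
- have [[q0 Aq0]|A0] := pselect (A !=set0); last first.
    have spp : sublinear p /\ forall x, p x <= p x by [].
    by exists (exist _ p spp) => s As; case: A0; exists s.
  pose I := {q : T | A q}; pose F (i : I) := sval (sval i).
  have [| | |] := @inf_sublinear I (exist _ q0 Aq0) F.
  + move=> x; exists (- p (- x)) => -[[r [sr rp]] Ar]; rewrite /F /=.
    apply: le_trans (sublinear_geN x sr); by rewrite lerN2 rp.
  + move=> i j x y; have [ij|ji] := Atot _ _ (svalP i) (svalP j).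
      exists j; have [+ _] := (svalP (sval j)).1; move=> /(_ x y) /le_trans.
      by apply; rewrite lerD2r; move/asboolP: ij; apply.
    exists i; have [+ _] := (svalP (sval i)).1; move=> /(_ x y) /le_trans.
    by apply; rewrite lerD2l; move/asboolP: ji; apply.
  + move=> i t x t0; exists i; have [_ +] := (svalP (sval i)).1; exact.
  move=> sr rF.
  have rp : forall x, inf (range (F ^~ x)) <= p x.
    move=> x; apply: le_trans (rF (exist _ q0 Aq0) x) _.
    by have [_] := svalP q0; apply.
  exists (mkT _ (conj sr rp)) => s As; apply/asboolP => x /=.
  exact: (rF (exist _ s As)).
- exists q; split => // r sr rq.
  have rp x : r x <= p x := le_trans (rq x) (qp x).
  by have /(congr1 sval) := qmin (mkT _ (conj sr rp)) (asboolT rq).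
Qed.

(** A minimal sublinear [q] is linear. For fixed [y] the infimum over [t >= 0] of
    [q (x + t *: y) - t * q y] is sublinear and at most [q], hence equal to [q]; the index [t = 1]
    then gives superadditivity. *)
Lemma hahn_banach p : sublinear p ->
  exists g : V -> R, [/\ forall x y, g (x + y) = g x + g y,
    forall t x, g (t *: x) = t * g x & forall x, g x <= p x].
Proof.
move=> /minimal_sublinear[q [sq qp qmin]]; exists q.
have qsup x y : q x + q y <= q (x + y).
  pose nn (t : R) t0 : {t : R | 0 <= t} := exist _ t t0.
  pose F (i : {t : R | 0 <= t}) x := q (x + sval i *: y) - sval i * q y.
  have [| | |sr rF] := @inf_sublinear _ (nn _ (lexx 0)) F.
  - move=> z; exists (- q (- z)) => -[t t0]; rewrite /F /=.
    rewrite -(sublinearZ _ sq t0); have [+ _] := sq.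
    by move=> /(_ (z + t *: y) (- z)); rewrite addrAC subrr add0r; lra.
  - move=> [t t0] [u u0] z w; exists (nn _ (addr_ge0 t0 u0)).
    rewrite /F /= scalerDl mulrDl addrACA.
    by have [+ _] := sq; move=> /(_ (z + t *: y) (w + u *: y)); lra.
  - move=> [t t0] u z u0; exists (nn _ (mulr_ge0 (ltW u0) t0)).
    rewrite /F /= -scalerA -scalerDr (sublinearZ _ sq (ltW u0)).
    by rewrite mulrBr mulrA.
  have rq z : inf (range (F ^~ z)) <= q z.
    apply: le_trans (rF (nn _ (lexx 0)) z) _.
    by rewrite /F /= scale0r mul0r addr0 subr0.
  have := rF (nn _ ler01) x.
  have /(congr1 (@^~ x)) -> := qmin _ sr rq.
  by rewrite /F /= scale1r mul1r lerBrDr.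
have qD x y : q (x + y) = q x + q y.
  by apply/eqP; rewrite eq_le qsup andbT; case: sq => + _; exact.
have qN x : q (- x) = - q x.
  have := qD x (- x); rewrite subrr sublinear0//; lra.
split => // t x; have [t0|t0] := leP 0 t; first by rewrite sublinearZ.
rewrite -[in LHS](opprK t) scaleNr qN sublinearZ// ?oppr_ge0 ?ltW//.
by rewrite mulNr opprK.
Qed.

End HahnBanach.

(** * Real scaling and real functionals *)

Definition rscale (R : realType) (s : scalar_kind)
  (X : lmodType (scalar_field R s)) (t : R) (x : X) : X := sreal t *: x.

Notation "t *r x" := (rscale t x) (at level 40).

Section RealScaling.
Context {R : realType} {s : scalar_kind}.
Local Notation K := (scalar_field R s).

Lemma srealN (t : R) : sreal (- t) = - sreal t :> K.
Proof. by apply/eqP; rewrite -addr_eq0 -srealD addNr sreal0. Qed.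

Lemma rnormN (X : normedModType K) (x : X) : rnorm (- x) = rnorm x.
Proof. by rewrite /rnorm normrN. Qed.

Lemma rnorm_srealE (t : R) : rnorm (sreal t : K^o) = `|t|.
Proof.
have [t0|t0] := leP 0 t; first by rewrite rnorm_sreal ?ger0_norm.
rewrite -[in LHS](opprK t) srealN (rnormN (sreal (- t) : K^o)).
by rewrite rnorm_sreal ?ltr0_norm// oppr_ge0 ltW.
Qed.

Section Lmodule.
Context {X : lmodType K}.
Implicit Types (t u : R) (x y : X).

Lemma rscaleA t u x : t *r (u *r x) = (t * u) *r x.
Proof. by rewrite /rscale scalerA -srealM. Qed.
Lemma rscale1 x : 1 *r x = x.
Proof. by rewrite /rscale sreal1 scale1r. Qed.
Lemma rscaleDr t x y : t *r (x + y) = t *r x + t *r y.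
Proof. exact: scalerDr. Qed.
Lemma rscaleDl t u x : (t + u) *r x = t *r x + u *r x.
Proof. by rewrite /rscale srealD scalerDl. Qed.
Lemma rscale0r t : t *r (0 : X) = 0.
Proof. exact: scaler0. Qed.
Lemma rscale0l x : 0 *r x = 0.
Proof. by rewrite /rscale sreal0 scale0r. Qed.
Lemma rscaleNl t x : (- t) *r x = - (t *r x).
Proof. by rewrite /rscale srealN scaleNr. Qed.
Lemma rscaleBr t x y : t *r (x - y) = t *r x - t *r y.
Proof. exact: scalerBr. Qed.
Lemma rscaleBl t u x : (t - u) *r x = t *r x - u *r x.
Proof. by rewrite rscaleDl rscaleNl. Qed.

(** An alias that carries the real vector space structure, so that [hahn_banach] applies to complex
    scalars as well. *)
Definition realified : Type := X.
HB.instance Definition _ := GRing.Zmodule.copy realified X.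
HB.instance Definition _ := GRing.Zmodule_isLmodule.Build R realified
  rscaleA rscale1 (fun t => rscaleDr t) (fun x t u => rscaleDl t u x).

Definition rconvex (C : set X) := forall x y t, 0 <= t <= 1 ->
  C x -> C y -> C (t *r x + (1 - t) *r y).

Definition rsubspace (L : set X) :=
  L 0 /\ forall t x y, L x -> L y -> L (t *r x + y).

Lemma rsubspaceZ L t x : rsubspace L -> L x -> L (t *r x).
Proof. by move=> [L0 LP] Lx; rewrite -[_ *r _]addr0; exact: LP. Qed.

Lemma rsubspaceD L x y : rsubspace L -> L x -> L y -> L (x + y).
Proof. by move=> [_ LP] Lx Ly; rewrite -(rscale1 x); exact: LP. Qed.

Lemma rsubspaceN L x : rsubspace L -> L x -> L (- x).
Proof. by move=> sL /(rsubspaceZ (-1) sL); rewrite rscaleNl rscale1. Qed.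

Lemma rsubspaceB L x y : rsubspace L -> L x -> L y -> L (x - y).
Proof. by move=> sL Lx /(rsubspaceN sL); exact: rsubspaceD. Qed.

Lemma rsubspace_convex L : rsubspace L -> rconvex L.
Proof. by move=> sL x y t _ Lx Ly; case: (sL) => _; apply=> //; exact: rsubspaceZ. Qed.

End Lmodule.

Section NormedModule.
Context {X : normedModType K}.
Implicit Types (t u : R) (x y : X) (g : X -> R).

Lemma linear_rsubspace (L : set X) : linear_subspace L -> rsubspace L.
Proof. by move=> [L0 LP]; split => // t x y; exact: LP. Qed.

Lemma rnorm_rscale t x : rnorm (t *r x) = `|t| * rnorm x.
Proof. by rewrite /rscale rnormZ rnorm_srealE. Qed.

Lemma rnorm_distC x y : rnorm (x - y) = rnorm (y - x).
Proof. by rewrite -rnormN opprB. Qed.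

Lemma rnorm_triangle y x z : rnorm (x - z) <= rnorm (x - y) + rnorm (y - z).
Proof. by rewrite (le_trans _ (ler_rnormD _ _))// addrA subrK. Qed.

Lemma ler_rnormB x y : rnorm (x - y) <= rnorm x + rnorm y.
Proof. by rewrite -(rnormN y) ler_rnormD. Qed.

Lemma ler_rnorm_dist x y : `|rnorm x - rnorm y| <= rnorm (x - y).
Proof.
have := ler_rnormD (x - y) y; have := ler_rnormD (y - x) x.
by rewrite !subrK (rnorm_distC y x) => h1 h2; rewrite ler_norml; lra.
Qed.

Definition real_functional g :=
  [/\ forall x y, g (x + y) = g x + g y, forall t x, g (t *r x) = t * g x
    & exists M, forall x, `|g x| <= M * rnorm x].

Section RealFunctionalTheory.
Variable g : X -> R.
Hypothesis rg : real_functional g.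

Lemma rfunD x y : g (x + y) = g x + g y. Proof. by case: rg. Qed.
Lemma rfunZ t x : g (t *r x) = t * g x. Proof. by case: rg. Qed.
Lemma rfun0 : g 0 = 0. Proof. by rewrite -(rscale0l 0) rfunZ mul0r. Qed.
Lemma rfunN x : g (- x) = - g x.
Proof. by rewrite -[x in LHS]rscale1 -rscaleNl rfunZ mulN1r. Qed.
Lemma rfunB x y : g (x - y) = g x - g y. Proof. by rewrite rfunD rfunN. Qed.
Lemma rfun_bound : exists2 M, 0 < M & forall x, `|g x| <= M * rnorm x.
Proof.
case: rg => _ _ [M gM]; exists (Num.max M 1); first by rewrite lt_max ltr01 orbT.
move=> x; apply: le_trans (gM x) _; rewrite ler_wpM2r ?rnorm_ge0//.
by rewrite le_max lexx.
Qed.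

End RealFunctionalTheory.

(* Any linear functional dominated by the sublinear functional
   [y |-> inf (rnorm (y + l (x - c)) - l d)] (over [l >= 0] and [c] in [C])
   is dominated by the norm (take [l = 0]) and is at most [- d] on [c - x]
   (take [l = 1]). *)
Lemma separation (C : set X) x d : C !=set0 -> rconvex C ->
  (forall c, C c -> d <= rnorm (x - c)) ->
  exists2 g, real_functional g /\ (forall y, `|g y| <= rnorm y) &
    forall c, C c -> d <= g (x - c).
Proof.
move=> [c0 Cc0] cC dC.
pose I := {i : R * X | 0 <= i.1 /\ C i.2}.
pose mkI l c (l0 : 0 <= l) (Cc : C c) : I := exist _ (l, c) (conj l0 Cc).
pose F (i : I) (y : @realified X) :=
  rnorm ((y : X) + (sval i).1 *r (x - (sval i).2)) - (sval i).1 * d.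
have [| | |sp pF] := @inf_sublinear _ _ I (mkI _ _ (lexx 0) Cc0) F.
(* The infimum is finite: [x - c] has norm at least [d], so [y + l (x - c)] has norm at least [l d]
   minus the norm of [y]. *)
- move=> y; exists (- rnorm (y : X)) => -[[l c] [/= l0 Cc]]; rewrite /F /=.
  have := ler_rnormB ((y : X) + l *r (x - c)) y.
  rewrite addrAC subrr add0r rnorm_rscale ger0_norm//.
  by have := ler_wpM2l l0 (dC c Cc); lra.
- move=> [[l c] [/= l0 Cc]] [[m e] [/= m0 Ce]] y z.
  (* The merged index has weight [l + m] and the weighted mean of [c] and [e] as its point; two zero
     weights have no mean and are split off. *)
  have [k Ck kE] : exists2 k, C k &
      (l + m) *r (x - k) = l *r (x - c) + m *r (x - e).
    have [lm0|lm0] := eqVneq (l + m) 0.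
      have [-> ->] : l = 0 /\ m = 0 by split; lra.
      by exists c => //; rewrite addr0 !rscale0l addr0.
    have lm : 0 < l + m by rewrite lt_neqAle eq_sym lm0 addr_ge0.
    exists ((l / (l + m)) *r c + (1 - l / (l + m)) *r e).
      apply: cC => //; rewrite divr_ge0 ?(ltW lm)//=.
      by rewrite ler_pdivrMr// mul1r lerDl.
    rewrite !rscaleBr rscaleDl rscaleDr !rscaleA.
    have -> : (l + m) * (l / (l + m)) = l by field.
    have -> : (l + m) * (1 - l / (l + m)) = m by field.
    by rewrite opprD addrACA.
  exists (mkI _ _ (addr_ge0 l0 m0) Ck); rewrite /F /= kE addrACA mulrDl.
  by have := ler_rnormD ((y : X) + l *r (x - c)) (z + m *r (x - e)); lra.
- move=> [[l c] [/= l0 Cc]] t y t0; exists (mkI _ _ (mulr_ge0 (ltW t0) l0) Cc).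
  rewrite /F /= -rscaleA -[t *: _]/(t *r (y : X)) -rscaleDr rnorm_rscale.
  by rewrite gtr0_norm// mulrBr mulrA.
have [g [gD gZ gp]] := hahn_banach sp.
have gle (y : X) : g y <= rnorm y.
  apply: le_trans (gp y) _; apply: le_trans (pF (mkI _ _ (lexx 0) Cc0) y) _.
  by rewrite /F /= rscale0l addr0 mul0r subr0.
have gN (y : X) : g (- y) = - g y.
  by rewrite -mulN1r -gZ scaleN1r.
have gabs (y : X) : `|g y| <= rnorm y.
  by rewrite ler_norml gle andbT lerNl -gN -(rnormN y) gle.
exists g; first by split => //; split => //; exists 1 => y; rewrite mul1r.
move=> c Cc; rewrite -lerN2 -gN opprB.
apply: le_trans (gp (c - x)) _; apply: le_trans (pF (mkI _ _ ler01 Cc) _) _.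
by rewrite /F /= rscale1 -(opprB x c) addNr rnorm0 mul1r sub0r.
Qed.

(** Separation of [x] from the singleton of 0, which lies at distance [rnorm x]. *)
Lemma norming_functional x : exists2 g, real_functional g &
  (forall y, `|g y| <= rnorm y) /\ g x = rnorm x.
Proof.
have [| | |g [rg g1] gx] := @separation [set 0] x (rnorm x).
- by exists 0.
- by move=> _ _ t _ -> ->; rewrite /= !rscale0r addr0.
- by move=> _ ->; rewrite subr0.
exists g => //; split => //; apply/eqP; rewrite eq_le.
by have := gx 0 erefl; rewrite subr0 => ->; rewrite andbT (le_trans (ler_norm _)).
Qed.

(** Closedness through real distances, the form that [separation] can use; it avoids neighbourhoods
    measured in the scalar field. *)
Definition nclosed (C : set X) :=
  forall x, (forall e, 0 < e -> exists2 c, C c & rnorm (x - c) < e) -> C x.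

Lemma nclosedPn (C : set X) x : nclosed C -> ~ C x ->
  exists2 d, 0 < d & forall c, C c -> d <= rnorm (x - c).
Proof.
move=> clC nCx; apply: contrapT => dC; apply/nCx/clC => e e0.
apply: contrapT => ec; apply: dC; exists e => // c Cc.
by rewrite leNgt; apply/negP => xce; apply: ec; exists c.
Qed.

(** The separating [g] is at least [d] on [x - L]. If it did not vanish at some [y] in [L], a
    multiple of [y] would bring it down to 0 there. *)
Lemma annihilator_dist (L : set X) x d : rsubspace L -> 0 < d ->
  (forall c, L c -> d <= rnorm (x - c)) ->
  exists g, [/\ real_functional g, forall y, L y -> g y = 0 & 0 < g x].
Proof.
move=> sL d0 dL; have L0 := sL.1.
have [||g [rg g1] gL] := @separation L x d _ _ dL.
- by exists 0.
- exact: rsubspace_convex.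
have gx : 0 < g x by have := gL _ L0; rewrite subr0; exact: lt_le_trans.
exists g; split => // y Ly; apply: contrapT => /eqP gy.
have := gL _ (rsubspaceZ (g x / g y) sL Ly).
by rewrite (rfunB rg) (rfunZ rg) divfK// subrr leNgt d0.
Qed.

Lemma annihilator (L : set X) x : rsubspace L -> nclosed L -> ~ L x ->
  exists g, [/\ real_functional g, forall y, L y -> g y = 0 & g x = 1].
Proof.
move=> sL clL /(nclosedPn clL)[d d0 dL].
have [g [rg g0 gx]] := annihilator_dist sL d0 dL.
exists (fun y => g y / g x); split.
- split => [y z|t y|]; first by rewrite (rfunD rg) mulrDl.
    by rewrite (rfunZ rg) mulrA.
  have [M M0 gM] := rfun_bound rg; exists ((g x)^-1 * M) => y.
  by rewrite normrM mulrC (gtr0_norm (x := _^-1)) ?invr_gt0// -mulrA ler_pM2l ?invr_gt0.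
- by move=> y /g0 ->; rewrite mul0r.
- by rewrite divff// gt_eqF.
Qed.

End NormedModule.
End RealScaling.

(** * Real and imaginary parts; dual elements and their real parts *)

Section Scalars.
Context {R : realType} {s : scalar_kind}.
Local Notation K := (scalar_field R s).

Lemma ltr_sreal (x y : R) : (sreal x < sreal y :> K) = (x < y).
Proof.
by rewrite !lt_neqAle ler_sreal (inj_eq (can_inj (@srealK R s))).
Qed.

(* Over the reals [sim] and [sI] are [0], so that [scalarE] reads
   [a = Re a + Im a * i] for both kinds of scalars. *)
Definition sim : K -> R :=
  match s return scalar_field R s -> R with
  | RealScalars => fun=> 0 | ComplexScalars => @complex.Im R end.

Definition sI : K :=
  match s return scalar_field R s with
  | RealScalars => 0 | ComplexScalars => 'i%C end.

Lemma sreD (a b : K) : sre (a + b) = sre a + sre b.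
Proof. by case: s a b => // -[? ?] [? ?]. Qed.

Lemma sre_srealM (t : R) (a : K) : sre (sreal t * a) = t * sre a.
Proof. by case: s a => // -[? ?] /=; rewrite mul0r subr0. Qed.

Lemma sreN (a : K) : sre (- a) = - sre a.
Proof. by case: s a => // -[]. Qed.

Lemma sreB (a b : K) : sre (a - b) = sre a - sre b.
Proof. by rewrite sreD sreN. Qed.

Lemma sre_sI : sre sI = 0.
Proof. by rewrite /sI; case: s. Qed.

Lemma scalarE (a : K) : a = sreal (sre a) + sreal (sim a) * sI.
Proof.
rewrite /sim /sI; case: s a => [a|[p q]] /=; first by rewrite mulr0 addr0.
by apply/eqP; rewrite eq_complex /=; apply/andP; split; apply/eqP; ring.
Qed.

Lemma sim_sre (a : K) : sim a = - sre (sI * a).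
Proof.
rewrite /sim /sI; case: s a => [a|[p q]] /=; first by rewrite mul0r oppr0.
by ring.
Qed.

(** The case split behind uniform computations: over the reals all terms with [sim] vanish, over the
    complex numbers [sI] squares to -1. *)
Lemma sim_eq0_or (a : K) : sim a = 0 \/ sI * sI = -1.
Proof.
rewrite /sim /sI; case: s a => [a|a]; first by left.
by right; apply/eqP; rewrite eq_complex /=; apply/andP; split; apply/eqP; ring.
Qed.

Lemma ler_sre (a : K) : `|sre a| <= rnorm (a : K^o).
Proof.
rewrite -(ler_sreal (s := s)) sreal_rnorm; case: s a => //= -[p q] /=.
rewrite normc_def /= lecR -sqrtr_sqr ler_sqrt ?addr_ge0 ?sqr_ge0//.
by rewrite lerDl sqr_ge0.
Qed.

Lemma rnorm_sI : rnorm (sI : K^o) <= 1.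
Proof.
rewrite -(ler_sreal (s := s)) sreal_rnorm sreal1 /sI; case: s => /=.
  by rewrite normr0.
by rewrite normc_def /= expr0n expr1n add0r sqrtr1.
Qed.

Lemma rnorm_le_sre_sim (a : K) : rnorm (a : K^o) <= `|sre a| + `|sim a|.
Proof.
rewrite [in leLHS](scalarE a) (le_trans (ler_rnormD _ _))// rnorm_srealE lerD2l.
rewrite -[_ * _]/((sreal (sim a) : K) *: (sI : K^o)) rnormZ rnorm_srealE.
by rewrite ler_piMr ?rnorm_sI.
Qed.

Lemma cvg_rnormP (X : normedModType K) (T : Type) (F : set_system T)
    {FF : Filter F} (u : T -> X) x :
  u t @[t --> F] --> x <-> rnorm (u t - x) @[t --> F] --> (0 : R).
Proof.
split => [/cvgrPdist_lt ux|/cvgrPdist_lt ux].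
  apply/cvgrPdist_lt => e e0; have se0 : 0 < sreal e :> K.
    by rewrite -(@sreal0 R s) ltr_sreal.
  apply: filterS (ux _ se0) => t; rewrite sub0r normrN ger0_norm ?rnorm_ge0//.
  by rewrite rnorm_distC -(ltr_sreal) sreal_rnorm.
apply/cvgrPdist_lt => e e0; have eE := sre_ge0K (ltW e0).
have re0 : 0 < sre e by rewrite -ltr_sreal eE sreal0.
apply: filterS (ux _ re0) => t; rewrite sub0r normrN ger0_norm ?rnorm_ge0//.
by rewrite rnorm_distC -ltr_sreal sreal_rnorm eE.
Qed.

Lemma cvg0_le (T : Type) (F : set_system T) {FF : Filter F} (v w : T -> R) :
  (forall t, 0 <= v t <= w t) -> w t @[t --> F] --> (0 : R) ->
  v t @[t --> F] --> (0 : R).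
Proof.
move=> vw w0; apply: (squeeze_cvgr _ _ w0); last exact: cvg_cst.
by apply: nearW => t; exact: vw.
Qed.

Lemma cvg0D (T : Type) (F : set_system T) {FF : Filter F} (v w : T -> R) :
  v t @[t --> F] --> (0 : R) -> w t @[t --> F] --> (0 : R) ->
  v t + w t @[t --> F] --> (0 : R).
Proof. by move=> v0 w0; rewrite -[0]addr0; exact: cvgD. Qed.

Lemma cvg0Ml (T : Type) (F : set_system T) {FF : Filter F} M (v : T -> R) :
  v t @[t --> F] --> (0 : R) -> M * v t @[t --> F] --> (0 : R).
Proof. by move=> v0; rewrite -[0](mulr0 M); exact: cvgMr. Qed.

Lemma cvg_dist_le (T : Type) (F : set_system T) {FF : Filter F}
    (v w : T -> R) l :
  (forall t, `|v t - l| <= w t) -> w t @[t --> F] --> (0 : R) ->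
  v t @[t --> F] --> l.
Proof.
move=> vw w0; apply/subr_cvg0/norm_cvg0P.
by apply: (cvg0_le _ w0) => t; rewrite normr_ge0 vw.
Qed.

Lemma cvg0_dist (T : Type) (F : set_system T) {FF : Filter F}
    (v : T -> R) l :
  v t @[t --> F] --> l -> `|v t - l| @[t --> F] --> (0 : R).
Proof. by move=> vl; apply/norm_cvg0P/subr_cvg0. Qed.

Lemma cvg_sre (T : Type) (F : set_system T) {FF : Filter F}
    (c : T -> K^o) (l : K^o) :
  c t @[t --> F] --> l -> sre (c t) @[t --> F] --> (sre l : R).
Proof.
move=> /cvg_rnormP; apply: cvg_dist_le => t.
by rewrite -sreB; exact: ler_sre.
Qed.

Lemma cvg_sre_sI (T : Type) (F : set_system T) {FF : Filter F}
    (c : T -> K^o) (l : K^o) :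
  sre (c t) @[t --> F] --> (sre l : R) ->
  sre (sI * c t) @[t --> F] --> (sre (sI * l) : R) ->
  c t @[t --> F] --> l.
Proof.
move=> /cvg0_dist c1 /cvg0_dist c2; apply/cvg_rnormP.
apply: (cvg0_le _ (cvg0D c1 c2)) => t.
rewrite rnorm_ge0/= -!sreB -mulrBr -(normrN (sre (sI * _))) -sim_sre.
exact: rnorm_le_sre_sim.
Qed.

Lemma bounded_additive_continuous (X Y : normedModType K) (f : X -> Y) M :
  (forall x y, f (x - y) = f x - f y) ->
  (forall x, rnorm (f x) <= M * rnorm x) -> continuous f.
Proof.
move=> fB fM x; apply/cvg_rnormP.
have xx0 : rnorm (y - x) @[y --> x] --> (0 : R).
  by apply/(cvg_rnormP id); exact: cvg_id.
by apply: (cvg0_le _ (cvg0Ml M xx0)) => y; rewrite rnorm_ge0 -fB fM.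
Qed.

Section Functionals.
Context {X : normedModType K}.
Implicit Types (f : dual_space X) (x y : X) (g : X -> R).

(** The functional with real part [g] is [g x - i g (i x)]; over the reals [sI] is 0 and it is [g]
    itself. *)
Lemma real_functional_dual g : real_functional g ->
  exists f, forall x, sre (f x) = g x.
Proof.
move=> rg; have [M M0 gM] := rfun_bound rg.
pose f x : K^o := sreal (g x) - sreal (g (sI *: x)) * sI.
have fD x y : f (x + y) = f x + f y.
  rewrite /f scalerDr !(rfunD rg) !srealD mulrDl opprD -!addrA.
  by congr (_ + _); rewrite addrCA.
have gZ a x : g (a *: x) = sre a * g x + sim a * g (sI *: x).
  rewrite [in LHS](scalarE a) scalerDl -scalerA (rfunD rg).
  by rewrite -2!/(_ *r _) !(rfunZ rg).
have fZ a x : f (a *: x) = a *: f x.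
  have -> : f (a *: x) = sreal (sre a * g x + sim a * g (sI *: x)) -
      sreal (sre a * g (sI *: x) + sim a * g ((sI * sI) *: x)) * sI.
    have e : sI *: (a *: x) = a *: (sI *: x) by rewrite !scalerA mulrC.
    by rewrite /f e (gZ a x) (gZ a (sI *: x)) scalerA.
  rewrite -[RHS]/(a * (sreal (g x) - sreal (g (sI *: x)) * sI)).
  rewrite [in RHS](scalarE a) !srealD !srealM.
  have [->|sI2] := sim_eq0_or a; last rewrite sI2 scaleN1r (rfunN rg) srealN.
    by rewrite !sreal0; ring.
  set p := sreal (sre a); set q := sreal (sim a).
  set G := sreal (g x); set H := sreal (g _).
  transitivity (p * G + q * G * sI - p * H * sI - q * H * (sI * sI)); last by ring.
  by rewrite sI2; ring.
have lf : linear f by move=> a x y; rewrite fD fZ.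
have cf : continuous f.
  apply: (@bounded_additive_continuous _ _ _ (M + M)) => [x y|x].
    by rewrite fD -scaleN1r fZ scaleN1r.
  rewrite (le_trans (ler_rnormB _ _))// rnorm_srealE mulrDl lerD//.
  rewrite -[_ * _]/((sreal _ : K) *: (sI : K^o)) rnormZ rnorm_srealE.
  rewrite (le_trans (ler_piMr _ rnorm_sI))// (le_trans (gM _))//.
  by rewrite ler_pM2l// rnormZ ler_piMl ?rnorm_ge0 ?rnorm_sI.
have df : f \in (@dual_pred R s X) by apply/asboolP.
exists (DualSpace df) => x /=; rewrite /f sreB srealK.
suff -> : sre (sreal (g (sI *: x)) * sI) = 0 by rewrite subr0.
by rewrite sre_srealM sre_sI mulr0.
Qed.

Lemma dual_norm_bound f x : rnorm (f x) <= dual_norm f * rnorm x.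
Proof.
have [->|x0] := eqVneq x 0; first by rewrite linear0 rnorm0 mulr0 rnorm0.
have rx0 : 0 < rnorm x.
  rewrite lt_neqAle rnorm_ge0 andbT eq_sym; apply: contra_neq x0.
  exact: rnorm0_eq0.
have : rnorm ((rnorm x)^-1 *r x) <= 1.
  by rewrite rnorm_rscale gtr0_norm ?invr_gt0// mulVf ?gt_eqF.
move=> /(dual_norm_ub f); rewrite /rscale linearZ -/(_ *r _) rnorm_rscale.
by rewrite gtr0_norm ?invr_gt0// ler_pdivrMl// mulrC.
Qed.

Lemma dual_real_functional f : real_functional (fun x => sre (f x)).
Proof.
split => [x y|t x|]; first by rewrite linearD sreD.
  by rewrite /rscale linearZ sre_srealM.
exists (dual_norm f) => x; apply: le_trans (ler_sre _) _.
exact: dual_norm_bound.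
Qed.

(** The filter is a parameter because limits are taken both along [\oo] and along ultrafilters. *)
Definition rweak_cvg_to (F : set_system nat) (u : nat -> X) x :=
  forall g, real_functional g -> g (u k) @[k --> F] --> g x.

Lemma weak_cvgP (u : nat -> X) x : weak_cvg u x <-> rweak_cvg_to \oo u x.
Proof.
split => [ux g /real_functional_dual[f fg]|ux f].
  have <- : (fun x => sre (f x)) = g by exact/funext.
  exact: cvg_sre (ux f).
apply: cvg_sre_sI; first exact: ux (dual_real_functional f).
exact: (ux _ (dual_real_functional (sI *: f))).
Qed.

End Functionals.
End Scalars.

(** * Limits along ultrafilters *)

Section Subsequences.

Lemma subseq_ge (phi : nat -> nat) k :
  {homo phi : i j / (i < j)%N} -> (k <= phi k)%N.
Proof.
by move=> phiI; elim: k => // k IH; exact: leq_ltn_trans IH (phiI _ _ (ltnSn k)).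
Qed.

Lemma cvg_subseq (T : topologicalType) (v : nat -> T) (l : T) (phi : nat -> nat) :
  {homo phi : i j / (i < j)%N} -> v k @[k --> \oo] --> l ->
  v (phi k) @[k --> \oo] --> l.
Proof.
move=> phiI vl A /vl [N _ NA]; exists N => // k /= Nk; apply: NA => /=.
exact: leq_trans Nk (subseq_ge k phiI).
Qed.

Lemma subseq_comp (phi psi : nat -> nat) :
  {homo phi : i j / (i < j)%N} -> {homo psi : i j / (i < j)%N} ->
  {homo phi \o psi : i j / (i < j)%N}.
Proof. by move=> phiI psiI i j /psiI/phiI. Qed.

Lemma subseq_exists (P : nat -> nat -> Prop) :
  (forall k N, exists2 j, (N <= j)%N & P k j) ->
  exists2 phi : nat -> nat, {homo phi : i j / (i < j)%N} &
    forall k, P k (phi k).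
Proof.
move=> H; have /choice[f fP] : forall kN : nat * nat, exists j,
    (kN.2 <= j)%N /\ P kN.1 j.
  by move=> [k N]; have [j] := H k N; exists j.
pose phi := fix phi k := if k is k'.+1 then f (k, (phi k').+1) else f (0, 0).
exists phi; last by case=> [|k]; [case: (fP (0, 0))|case: (fP (k.+1, (phi k).+1))].
apply: homo_ltn => [? ? ?|k]; first exact: ltn_trans.
by case: (fP (k.+1, (phi k).+1)).
Qed.

End Subsequences.

Section UltraLimits.
Context {R : realType}.
Implicit Types (U F : set_system nat).

(** Compactness of a segment gives a cluster point. It is a limit, since an ultrafilter missing one
    of its neighbourhoods would contain the complement. *)
Lemma ultra_limit U (v : nat -> R) (M : R) : UltraFilter U ->
  (forall k, `|v k| <= M) -> exists l : R, v k @[k --> U] --> l.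
Proof.
move=> ultraU vM.
have pU : ProperFilter (v k @[k --> U]) by exact: fmap_proper_filter.
have [|l [_ vl]] := @segment_compact R (- M) M _ pU.
  by apply: (@filterE _ U) => k /=; rewrite in_itv/= -ler_norml.
exists l; apply/cvgrPdist_lt => e e0.
have [//|UC] := in_ultra_setVsetC [set k | `|l - v k| < e] ultraU.
have [z [/= zC]] := vl [set z | ~ (`|l - z| < e)] [set z | `|l - z| < e] UC
  (nbhsx_ballx l e e0).
by [].
Qed.

Lemma cvg_along (T : topologicalType) F U (v : nat -> T) (l : T) :
  F `<=` U -> v k @[k --> F] --> l -> v k @[k --> U] --> l.
Proof. by move=> FU vl A /vl; exact: FU. Qed.

Lemma cvg_ler F {FF : ProperFilter F} (v w : nat -> R) (a b : R) :
  v k @[k --> F] --> a -> w k @[k --> F] --> b -> (forall k, v k <= w k) ->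
  a <= b.
Proof. by move=> va wb vw; apply: (ler_cvg_to va wb); exact: nearW. Qed.

(* If along every ultrafilter [u] has a limit point in [Y], and the
   countably many [D n] separate the limit points, then a subsequence along which
   all [D n] converge has only one limit point. *)
Lemma ultra_subseq (T : Type) (u : nat -> T) (G : set (T -> R))
    (D : nat -> T -> R) (Y : set T) :
  (forall n, G (D n)) ->
  (forall U, UltraFilter U ->
     exists2 x, Y x & forall g, G g -> g (u k) @[k --> U] --> g x) ->
  (forall x y, Y x -> Y y -> (forall n, D n x = D n y) ->
     forall g, G g -> g x = g y) ->
  exists2 phi : nat -> nat, {homo phi : i j / (i < j)%N} &
    exists2 x, Y x & forall g, G g -> g (u (phi k)) @[k --> \oo] --> g x.
Proof.
move=> GD cptY sepY.
have [U [ultraU ooU]] := @ultraFilterLemma nat \oo _.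
have [x Yx xU] := cptY U ultraU.
(* The k-th index brings the first [k.+1] functionals within [k.+1%:R^-1] of their values at [x];
   such indices form a set of [U], so it meets every tail. *)
have [k N|phi phiI phiP] := @subseq_exists
    (fun k j => forall n, (n <= k)%N -> `|D n x - D n (u j)| < k.+1%:R^-1).
  have k0 : 0 < k.+1%:R^-1 :> R by rewrite invr_gt0.
  have Uk : U [set j | forall n : 'I_k.+1, `|D n x - D n (u j)| < k.+1%:R^-1].
    apply: filter_forall => n.
    by have /cvgrPdist_lt/(_ _ k0) := xU _ (GD n).
  have UN : U [set j | (N <= j)%N] by apply: ooU; exists N.
  have [j [jk Nj]] := filter_ex (filterI Uk UN).
  by exists j => // n nk; exact: (jk (Ordinal (nk : (n < k.+1)%N))).
have Dphi n : D n (u (phi k)) @[k --> \oo] --> D n x.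
  apply/cvgrPdist_lt => e e0.
  have [N _ NP] : \forall k \near \oo, k.+1%:R^-1 < e.
    by have /cvgrPdist_lt/(_ _ e0) := @cvg_harmonic R; apply: filterS => k;
      rewrite sub0r normrN ger0_norm ?harmonic_ge0.
  exists (maxn n N) => // k /=; rewrite geq_max => /andP[nk Nk].
  exact: lt_trans (phiP k n nk) (NP k Nk).
exists phi => //; exists x => // g Gg; apply/cvgrPdist_lt => e e0.
apply: contrapT => notcvg.
(* If [g] failed to converge, the images of the bad indices would generate a filter. The limit along
   a finer ultrafilter agrees with [x] on all [D n], hence on [g], although [g] stays at distance
   [e] there. *)
pose bad := [set k | ~ (`|g x - g (u (phi k))| < e)].
have pF : ProperFilter (filter_from (\oo : set_system nat)
    (fun A => phi @` (bad `&` A))).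
  apply: filter_from_proper; last first.
    move=> A [N _ NA]; apply: contrapT => bad0; apply: notcvg.
    exists N => // k Nk; apply: contrapT => kbad; apply: bad0.
    by exists (phi k), k => //; split => //; exact: NA.
  apply: filter_from_filter; first by exists setT; exact: filterT.
  move=> A B Aoo Boo; exists (A `&` B); first exact: filterI.
  by move=> _ [k [bk [Ak Bk]] <-]; split; exists k.
have [V [ultraV FV]] := ultraFilterLemma pF.
have [y Yy yV] := cptY V ultraV.
have Dxy n : D n x = D n y.
  apply: (@cvg_unique R (@Rhausdorff R) (D n (u k) @[k --> V])).
    apply: cvg_along FV _ => A /(Dphi n) [N _ NA].
    exists [set k | (N <= k)%N]; first by exists N.
    by move=> _ [k [_ Nk] <-]; exact: NA.
  exact: yV.
have Vbad : V (phi @` bad).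
  by apply: FV; exists setT; [exact: filterT|rewrite setIT].
have /cvgrPdist_lt/(_ _ e0) Vgood := yV _ Gg.
have [_ [[k bk <-] gk]] := filter_ex (filterI Vbad Vgood).
by apply: bk; rewrite (sepY _ _ Yx Yy Dxy _ Gg).
Qed.

Context {s : scalar_kind}.
Local Notation K := (scalar_field R s).

(** Banach-Alaoglu along an ultrafilter: linearity and the common bound [M] pass to pointwise
    limits. *)
Lemma ultra_functional (V : normedModType K) U (L : nat -> V -> R) (M : R) :
  UltraFilter U -> (forall k, real_functional (L k)) ->
  (forall k v, `|L k v| <= M * rnorm v) ->
  exists2 h, real_functional h & forall v, L k v @[k --> U] --> h v.
Proof.
move=> ultraU rL LM.
have /choice[h hP] : forall v, exists l : R, L k v @[k --> U] --> l.
  by move=> v; apply: (@ultra_limit U _ (M * rnorm v)).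
have hu v l : L k v @[k --> U] --> l -> h v = l.
  move=> vl; apply: (@cvg_unique R (@Rhausdorff R) (L k v @[k --> U])) => //.
  exact: hP.
exists h => //; split => [x y|t x|].
- apply: hu; have -> : L^~ (x + y) = fun k => L k x + L k y.
    by apply/funext => k; rewrite (rfunD (rL k)).
  by apply: cvgD; exact: hP.
- apply: hu; have -> : L^~ (t *r x) = fun k => t * L k x.
    by apply/funext => k; rewrite (rfunZ (rL k)).
  by apply: cvgMr; exact: hP.
- exists M => x; rewrite ler_norml; apply/andP; split.
    apply: (cvg_ler (cvg_cst (- (M * rnorm x))) (hP x)) => k.
    by have := LM k x; rewrite ler_norml => /andP[].
  apply: (cvg_ler (hP x) (cvg_cst (M * rnorm x))) => k.
  exact: le_trans (ler_norm _) (LM k x).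
Qed.

End UltraLimits.

(** * Weak sequential compactness in reflexive spaces *)

Lemma half_gt0 (R : realFieldType) (e : R) : 0 < e -> 0 < e / 2.
Proof. by move=> e0; rewrite divr_gt0. Qed.

Section WeakConvergence.
Context {R : realType} {s : scalar_kind}.
Local Notation K := (scalar_field R s).
Context {X : normedModType K}.
Implicit Types (u v w : nat -> X) (x y : X) (C : set X) (phi : nat -> nat).

(** Weak lower semicontinuity of the norm, tested on a functional that norms the limit. *)
Lemma rweak_norm_le (F : set_system nat) {FF : ProperFilter F} u x
    (d : nat -> R) (l : R) :
  rweak_cvg_to F u x -> (forall k, rnorm (u k) <= d k) ->
  d k @[k --> F] --> l -> rnorm x <= l.
Proof.
move=> ux ud dl; have [g rg [g1 <-]] := norming_functional x.
apply: (cvg_ler (ux _ rg) dl) => k; apply: le_trans (ud k).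
exact: le_trans (ler_norm _) (g1 _).
Qed.

(** Mazur's theorem: a functional separating [x] from [C] would keep [g (x - u k)] above some
    [d > 0]. *)
Lemma rweak_closed C (F : set_system nat) {FF : ProperFilter F} u x :
  nclosed C -> rconvex C -> (forall k, C (u k)) -> rweak_cvg_to F u x -> C x.
Proof.
move=> clC cC Cu ux; apply: contrapT => /(nclosedPn clC)[d d0 dC].
have [|g [rg _] gC] := @separation _ _ _ C x d _ cC dC; first by exists (u 0).
suff : d <= 0 by rewrite leNgt d0.
rewrite -[0](subrr (g x)).
apply: (cvg_ler (cvg_cst d) (cvgB (cvg_cst (g x)) (ux _ rg))) => k.
by rewrite -(rfunB rg) gC.
Qed.

Lemma rweakD (F : set_system nat) {FF : Filter F} u v x y :
  rweak_cvg_to F u x -> rweak_cvg_to F v y ->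
  rweak_cvg_to F (fun k => u k + v k) (x + y).
Proof.
move=> ux vy g rg; rewrite (rfunD rg).
under eq_fun do rewrite (rfunD rg).
by apply: cvgD; [exact: ux|exact: vy].
Qed.

Lemma rweakZ (F : set_system nat) {FF : Filter F} u x (t : R) :
  rweak_cvg_to F u x -> rweak_cvg_to F (fun k => t *r u k) (t *r x).
Proof.
move=> ux g rg; rewrite (rfunZ rg); under eq_fun do rewrite (rfunZ rg).
by apply: cvgMr; exact: ux.
Qed.

Lemma rweakN (F : set_system nat) {FF : Filter F} u x :
  rweak_cvg_to F u x -> rweak_cvg_to F (fun k => - u k) (- x).
Proof.
move=> ux g rg; rewrite (rfunN rg); under eq_fun do rewrite (rfunN rg).
by apply: cvgN; exact: ux.
Qed.

Lemma rweakB (F : set_system nat) {FF : Filter F} u v x y :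
  rweak_cvg_to F u x -> rweak_cvg_to F v y ->
  rweak_cvg_to F (fun k => u k - v k) (x - y).
Proof. by move=> ux vy; apply: rweakD => //; exact: rweakN. Qed.

Lemma rweak_cst (F : set_system nat) {FF : Filter F} x :
  rweak_cvg_to F (fun=> x) x.
Proof. by move=> g _; exact: cvg_cst. Qed.

Lemma rweak_subseq u x phi : {homo phi : i j / (i < j)%N} ->
  rweak_cvg_to \oo u x -> rweak_cvg_to \oo (u \o phi) x.
Proof. by move=> phiI ux g /ux; exact: cvg_subseq. Qed.

Lemma cvg_rweak u x :
  rnorm (u k - x) @[k --> \oo] --> (0 : R) -> rweak_cvg_to \oo u x.
Proof.
move=> ux g rg; have [M M0 gM] := rfun_bound rg.
apply: (cvg_dist_le _ (cvg0Ml M ux)) => k; by rewrite -(rfunB rg).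
Qed.

(** The common ground of reflexive and Hilbert spaces, obtained from the bidual in one case and from
    Riesz representation in the other. *)
Definition ultra_reflexive := forall u (M : R), (forall k, rnorm (u k) <= M) ->
  forall U, UltraFilter U -> exists x, rweak_cvg_to U u x.

Definition bounded_weak_subseq := forall u (M : R),
  (forall k, rnorm (u k) <= M) ->
  exists2 phi : nat -> nat, {homo phi : i j / (i < j)%N} &
    exists x, rweak_cvg_to \oo (u \o phi) x.

Section Combinations.
Variable u : nat -> X.

Let comb n (c : nat -> R) := \sum_(i < n) c i *r u i.

Let comb_widen n m (c : nat -> R) : (n <= m)%N ->
  comb n c = comb m (fun i => if (i < n)%N then c i else 0).
Proof.
move=> nm; rewrite /comb (big_ord_widen _ (fun i => c i *r u i) nm) big_mkcond/=.
by apply: eq_bigr => i _; case: ifP => // _; rewrite rscale0l.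
Qed.

Let combD n c t c' : t *r comb n c + comb n c' = comb n (fun i => t * c i + c' i).
Proof.
rewrite /comb [t *r _]scaler_sumr -big_split/=; apply: eq_bigr => i _.
by rewrite rscaleDl -rscaleA.
Qed.

Let comb_rsubspace : rsubspace [set x | exists n c, x = comb n c].
Proof.
split; first by exists 0, (fun=> 0); rewrite /comb big_ord0.
move=> t _ _ [n [c ->]] [m [d ->]].
by rewrite (comb_widen c (leq_addr m n)) (comb_widen d (leq_addl n m)) combD;
  eexists; eexists.
Qed.

Let comb_rat n c (e : R) : 0 < e ->
  exists q : nat -> rat, rnorm (comb n c - comb n (ratr \o q)) < e.
Proof.
elim: n e => [|n IH] e e0.
  by exists (fun=> 0); rewrite /comb !big_ord0 subrr rnorm0.
have [q qe] := IH (e / 2) (half_gt0 e0).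
(* Changing the last coefficient by at most [d] moves the sum by at most [e / 2]; the [+ 1] covers
   [u n = 0]. *)
pose d := e / 2 / (rnorm (u n) + 1).
have un0 : 0 < rnorm (u n) + 1 by rewrite ltr_wpDl ?rnorm_ge0.
have d0 : 0 < d by rewrite !divr_gt0.
have [|r] := @rat_in_itvoo R (c n - d) (c n + d); first by lra.
rewrite in_itv/= => /andP[r1 r2].
exists (fun i => if (i < n)%N then q i else r).
rewrite /comb !big_ord_recr/= ltnn opprD addrACA -rscaleBl.
apply: le_lt_trans (ler_rnormD _ _) _.
have -> : \sum_(i < n) ((ratr (if (i < n)%N then q i else r) : R) *r u i)
    = comb n (ratr \o q) by apply: eq_bigr => i _; rewrite ltn_ord.
have ed : d * (rnorm (u n) + 1) = e / 2 by rewrite /d divfK// gt_eqF.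
have rd : `|c n - ratr r| <= d by rewrite ler_norml; lra.
rewrite rnorm_rscale; have := ler_wpM2r (rnorm_ge0 (u n)) rd; lra.
Qed.

(* The norming functionals of the rational combinations of the terms of [u]
   separate the points of the closed linear span of [u], which is described
   here as the set annihilated by every functional that annihilates [u]. *)
Lemma ultra_reflexive_subseq :
  (forall U, UltraFilter U -> exists x, rweak_cvg_to U u x) ->
  exists2 phi : nat -> nat, {homo phi : i j / (i < j)%N} &
    exists x, rweak_cvg_to \oo (u \o phi) x.
Proof.
move=> uU.
pose ratcomb (q : seq rat) := comb (size q) (fun i => ratr q`_i).
have /choice[G GP] : forall q, exists g, [/\ real_functional g,
    forall y, `|g y| <= rnorm y & g (ratcomb q) = rnorm (ratcomb q)].
  by move=> q; have [g rg [g1 gq]] := norming_functional (ratcomb q); exists g.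
(* Finite sequences of rationals are countable; a number that codes none of them falls back on the
   empty sequence. *)
pose D n := G (odflt [::] (unpickle n)).
pose Y x := forall g, real_functional g -> (forall k, g (u k) = 0) -> g x = 0.
have ratcomb_dense x e : Y x -> 0 < e -> exists q, rnorm (x - ratcomb q) < e.
  move=> Yx e0; apply: contrapT => ne.
  (* If no rational combination came within [e] of [x], no real one would come within [e / 2]; a
     functional vanishing on the span and positive at [x] would contradict [Y x]. *)
  have [|g [rg g0]] := annihilator_dist (x := x) comb_rsubspace (half_gt0 e0).
    move=> _ [n [c ->]]; rewrite leNgt; apply/negP => xc.
    have [q qe] := comb_rat n c (half_gt0 e0).
    apply: ne; exists (mkseq q n); rewrite /ratcomb size_mkseq.
    have -> : comb n (fun i => ratr (mkseq q n)`_i) = comb n (ratr \o q).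
      by apply: eq_bigr => i _; rewrite nth_mkseq.
    apply: le_lt_trans (rnorm_triangle (comb n c) _ _) _; lra.
  rewrite Yx ?ltxx// => k; apply: g0; exists k.+1, (fun i => (i == k)%:R).
  rewrite /comb big_ord_recr/= eqxx rscale1 big1 ?add0r// => i _.
  by rewrite ltn_eqF ?rscale0l.
have [|U ultraU|x y Yx Yy Dxy g rg|phi phiI [x _ ux]] :=
  @ultra_subseq R X u [set g | real_functional g] D Y.
- by move=> n; case: (GP (odflt [::] (unpickle n))).
- have [x xU] := uU U ultraU; exists x => // g rg g0.
  apply: (@cvg_unique R (@Rhausdorff R) (g (u k) @[k --> U])); first exact: xU.
  have -> : (fun k => g (u k)) = fun=> 0 by exact/funext.
  exact: cvg_cst.
- suff -> : x = y by [].
  apply/eqP; rewrite -subr_eq0; apply/eqP/rnorm0_eq0/eqP.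
  rewrite eq_le rnorm_ge0 andbT; apply/ler_addgt0Pl => e e0; rewrite addr0.
  have Yxy : Y (x - y) by move=> h rh h0; rewrite (rfunB rh) Yx ?Yy ?subrr.
  have [q qe] := ratcomb_dense _ _ Yxy (half_gt0 e0).
  have [rq q1 qq] := GP q.
  have : G q (x - y) = 0.
    by rewrite (rfunB rq); have := Dxy (pickle q); rewrite /D pickleK /= => ->;
      rewrite subrr.
  (* [G q] vanishes at [x - y] and norms [ratcomb q], so the norm of [ratcomb q] is at most that of
     [x - y - ratcomb q], which is below [e / 2]. *)
  have := q1 (x - y - ratcomb q); rewrite (rfunB rq (x - y)) qq => + Gq.
  rewrite Gq sub0r normrN ger0_norm ?rnorm_ge0// => h.
  have := ler_rnormD (x - y - ratcomb q) (ratcomb q); rewrite subrK; lra.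
- by exists phi => //; exists x.
Qed.

End Combinations.

Lemma ultra_reflexive_bounded_weak_subseq :
  ultra_reflexive -> bounded_weak_subseq.
Proof.
move=> ur u M uM; apply: ultra_reflexive_subseq => U ultraU.
exact: ur uM U ultraU.
Qed.

Lemma rnorm_dualE (f : dual_space X) : rnorm f = dual_norm f.
Proof. exact: srealK. Qed.

Lemma reflexive_ultra_reflexive : reflexive_banach X -> ultra_reflexive.
Proof.
move=> [_ refl] u M uM U ultraU.
have [||h rh hU] := @ultra_functional R s (dual_space X) U
  (fun k f => sre (f (u k))) M ultraU.
- move=> k; split => [f g|t f|]; first by rewrite -sreD.
    by rewrite -sre_srealM.
  exists (rnorm (u k)) => f; rewrite (le_trans (ler_sre _))// mulrC rnorm_dualE.
  exact: dual_norm_bound.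
- move=> k f; rewrite (le_trans (ler_sre _))// rnorm_dualE.
  rewrite (le_trans (dual_norm_bound _ _))// mulrC.
  by rewrite ler_wpM2r ?dual_norm_ge0.
have [Phi PhiP] := real_functional_dual rh.
have [x Px] := refl Phi; exists x => g /real_functional_dual[f fg].
have <- : (fun x => sre (f x)) = g by exact/funext.
by rewrite /= -Px PhiP; exact: hU.
Qed.

End WeakConvergence.
Arguments ultra_reflexive {R s} X.
Arguments bounded_weak_subseq {R s} X.

(** * Topology and Hilbert spaces *)

Section TopologyBridge.
Context {R : realType} {s : scalar_kind}.
Local Notation K := (scalar_field R s).
Context {X : normedModType K}.
Implicit Types (u : nat -> X) (x y : X) (A B C : set X) (phi : nat -> nat).

Lemma ler_sre_mono (a b : K) : a <= b -> sre a <= sre b.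
Proof.
rewrite -subr_ge0 => ab; rewrite -subr_ge0 -sreB.
by rewrite -(ler_sreal (s := s)) sre_ge0K// sreal0.
Qed.

Lemma nbhs_rnorm x B : nbhs x B ->
  exists2 e, 0 < e & forall y, rnorm (x - y) < e -> B y.
Proof.
move=> /nbhs_ballP[e /= e0 eB]; have eE := sre_ge0K (ltW e0).
exists (sre e); first by rewrite -(ltr_sreal (s := s)) eE sreal0.
move=> y; rewrite -(ltr_sreal (s := s)) sreal_rnorm eE => xy.
by apply: eB; rewrite -ball_normE.
Qed.

Lemma rnorm_nbhs x e : 0 < e -> nbhs x [set y | rnorm (x - y) < e].
Proof.
move=> e0; apply/nbhs_ballP; exists (sreal e).
  by rewrite /= -(@sreal0 R s) ltr_sreal.
by move=> y; rewrite -ball_normE /= -(ltr_sreal (s := s)) sreal_rnorm.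
Qed.

Lemma closed_nclosed C : closed C -> nclosed C.
Proof.
move=> clC x xC; apply: clC => B /nbhs_rnorm[e e0 eB].
by have [c Cc xc] := xC e e0; exists c; split => //; exact: eB.
Qed.

Lemma compact_subseq C u : compact C -> (forall k, C (u k)) ->
  exists2 phi : nat -> nat, {homo phi : i j / (i < j)%N} &
    exists2 x, C x & rnorm (u (phi k) - x) @[k --> \oo] --> (0 : R).
Proof.
move=> cC Cu; have [|x [Cx xu]] := cC (u k @[k --> \oo]) _.
  by apply: (@filterE _ (\oo : set_system nat)).
have [k N|phi phiI phiP] := @subseq_exists
    (fun k j => rnorm (u j - x) < k.+1%:R^-1).
  have k0 : 0 < k.+1%:R^-1 :> R by rewrite invr_gt0.
  have [|z [[j Nj <-] jx]] := xu (u @` [set j | (N <= j)%N]) _ _ (rnorm_nbhs x k0).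
    by exists N => // j Nj; exists j.
  by exists j => //; rewrite rnorm_distC.
exists phi => //; exists x => //; apply: (cvg0_le _ (@cvg_harmonic R)) => k.
by rewrite rnorm_ge0 ltW.
Qed.

Lemma bounded_set_rnorm A : bounded_set A -> exists M, forall x, A x -> rnorm x <= M.
Proof.
move=> [M [Mr MA]]; exists (sre (M + 1)) => x Ax; apply: ler_sre_mono.
by apply: (MA (M + 1)) => //; rewrite ltrDl.
Qed.

Lemma convex_rconvex C : convex C -> rconvex C.
Proof.
move=> cC x y t /andP[t0 t1] Cx Cy.
have st0 : 0 <= sreal t :> K by rewrite -(@sreal0 R s) ler_sreal.
have st1 : sreal t <= 1 :> K by rewrite -(@sreal1 R s) ler_sreal.
have h := set_mem (cC x y (Itv01 st0 st1) (mem_set Cx) (mem_set Cy)).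
have <- : sreal t *: x + (1 - sreal t) *: y = t *r x + (1 - t) *r y.
  by rewrite /rscale srealD srealN sreal1.
exact: h.
Qed.

Lemma banach_cvg u : banach X ->
  (forall e, 0 < e -> exists N, forall i j, (N <= i)%N -> (N <= j)%N ->
     rnorm (u i - u j) < e) ->
  exists x, rnorm (u k - x) @[k --> \oo] --> (0 : R).
Proof.
move=> bX uC; have /cvg_ex[x ux] : cvg (u k @[k --> \oo]).
  apply: bX; apply: cauchy_exP => e e0.
  have eE := sre_ge0K (ltW e0).
  have [|N NP] := uC (sre e); first by rewrite -(ltr_sreal (s := s)) eE sreal0.
  exists (u N); exists N => // k /= Nk; rewrite -ball_normE /=.
  by rewrite -eE -sreal_rnorm ltr_sreal NP.
by exists x; apply/cvg_rnormP.
Qed.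

Lemma weakly_seq_closedP C : weakly_seq_closed C ->
  forall u x, (forall k, C (u k)) -> rweak_cvg_to \oo u x -> C x.
Proof. by move=> clC u x Cu /weak_cvgP; exact: clC. Qed.

Definition rweak_compact C := forall u, (forall k, C (u k)) ->
  exists2 phi : nat -> nat, {homo phi : i j / (i < j)%N} &
    exists2 x, C x & rweak_cvg_to \oo (u \o phi) x.

Lemma weakly_seq_compactP C : weakly_seq_compact C -> rweak_compact C.
Proof.
move=> cC u /cC[phi [phiI [x Cx /weak_cvgP ux]]].
by exists phi => //; exists x.
Qed.

Lemma compact_rweak_compact C : compact C -> rweak_compact C.
Proof.
move=> cC u /(compact_subseq cC)[phi phiI [x Cx ux]].
by exists phi => //; exists x => //; exact: cvg_rweak.
Qed.

Lemma convex_weakly_seq_closed C : nclosed C -> rconvex C -> weakly_seq_closed C.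
Proof. by move=> clC cC u x Cu /weak_cvgP; exact: rweak_closed. Qed.

Lemma weakly_closed_seq C : weakly_closed C -> weakly_seq_closed C.
Proof.
move=> clC u x Cu ux.
apply: (@closed_cvg _ (weak_space X) \oo _ u C clC _ x); first exact: nearW.
apply/cvg_sup => f A [B [[D oD <-] Dx] DA].
have [N _ ND] := ux f D (open_nbhs_nbhs (conj oD Dx)).
by exists N => // k Nk; apply: DA; exact: ND.
Qed.

(** A functional composed with a projection is bounded for the maximum norm that the product
    carries. *)
Lemma rweak_pair (u : nat -> X * X) (z : X * X) : rweak_cvg_to \oo u z ->
  rweak_cvg_to \oo (fst \o u) z.1 /\ rweak_cvg_to \oo (snd \o u) z.2.
Proof.
move=> uz; split => g rg.
- apply: (uz (g \o fst)); split => [x y|t x|]; first by rewrite /= (rfunD rg).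
    by rewrite /= -(rfunZ rg).
  have [M M0 gM] := rfun_bound rg; exists M => x; apply: le_trans (gM _) _.
  rewrite ler_pM2l// -(ler_sreal (s := s)) !sreal_rnorm prod_normE.
  by rewrite comparable_le_max ?lexx// real_comparable.
- apply: (uz (g \o snd)); split => [x y|t x|]; first by rewrite /= (rfunD rg).
    by rewrite /= -(rfunZ rg).
  have [M M0 gM] := rfun_bound rg; exists M => x; apply: le_trans (gM _) _.
  rewrite ler_pM2l// -(ler_sreal (s := s)) !sreal_rnorm prod_normE.
  by rewrite comparable_le_max ?lexx ?orbT// real_comparable.
Qed.

End TopologyBridge.

(** * Inner products and the Riesz representation *)

Section Hilbert.
Context {R : realType} {s : scalar_kind}.
Local Notation K := (scalar_field R s).
Context {X : normedModType K}.
Implicit Types (x y z : X).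

(** The real part of the inner product: a real inner product with the same norm, enough to represent
    real functionals. *)
Definition real_dot (dot : X -> X -> R) :=
  [/\ forall x y, dot x y = dot y x,
      forall x y z, dot (x + y) z = dot x z + dot y z,
      forall t x y, dot (t *r x) y = t * dot x y
    & forall x, rnorm x ^+ 2 = dot x x].

Lemma sre_conj (a : K) : sre (sconj a) = sre a.
Proof. by case: s a => // -[]. Qed.

Lemma hilbert_real_dot : hilbert X -> banach X /\ exists dot, real_dot dot.
Proof.
move=> [bX [ip ipP]]; split => //; exists (fun x y => sre (ip x y)); split.
- by move=> x y; rewrite (hermitian_subproof x y) expr0 mul1r sre_conj.
- by move=> x y z; rewrite linearDl sreD.
- by move=> t x y; rewrite /rscale linearZl_LR sre_srealM.
- by move=> x; rewrite -ipP -sreal_rnorm !expr2 -srealM srealK.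
Qed.

Section RealDot.
Variable dot : X -> X -> R.
Hypothesis rdot : real_dot dot.

Lemma dotC x y : dot x y = dot y x. Proof. by case: rdot. Qed.
Lemma dotDl x y z : dot (x + y) z = dot x z + dot y z. Proof. by case: rdot. Qed.
Lemma dotZl t x y : dot (t *r x) y = t * dot x y. Proof. by case: rdot. Qed.
Lemma dotE x : rnorm x ^+ 2 = dot x x. Proof. by case: rdot. Qed.
Lemma dotDr x y z : dot x (y + z) = dot x y + dot x z.
Proof. by rewrite dotC dotDl !(dotC x). Qed.
Lemma dotZr t x y : dot x (t *r y) = t * dot x y.
Proof. by rewrite dotC dotZl dotC. Qed.
Lemma dotNl x y : dot (- x) y = - dot x y.
Proof. by rewrite -[x in LHS]rscale1 -rscaleNl dotZl mulN1r. Qed.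
Lemma dotNr x y : dot x (- y) = - dot x y.
Proof. by rewrite dotC dotNl dotC. Qed.

Definition dot_simp := (dotDl, dotDr, dotZl, dotZr, dotNl, dotNr).

Lemma cauchy_schwarz x y : `|dot x y| <= rnorm x * rnorm y.
Proof.
have [->|y0] := eqVneq y 0.
  by rewrite -(rscale0l 0) dotZr mul0r normr0 mulr_ge0 ?rnorm_ge0.
have ry : 0 < rnorm y.
  rewrite lt_neqAle rnorm_ge0 andbT eq_sym; apply: contra_neq y0.
  exact: rnorm0_eq0.
have b0 : 0 < dot y y by rewrite -dotE exprn_gt0.
rewrite -ler_sqr ?nnegrE ?mulr_ge0 ?rnorm_ge0// real_normK ?num_real//.
rewrite exprMn !dotE.
(* This squared norm expands to [b * (c * b - a ^+ 2)]. *)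
have := sqr_ge0 (rnorm (dot y y *r x - dot x y *r y)).
rewrite dotE !dot_simp (dotC y x).
set a := dot x y; set b := dot y y in b0 *; set c := dot x x => h.
have {}h : 0 <= b * (c * b - a ^+ 2) by apply: le_trans h _; lra.
by rewrite pmulr_rge0// subr_ge0 in h.
Qed.

Lemma dot_functional z : real_functional (dot z).
Proof.
split => [x y|t x|]; [exact: dotDr|exact: dotZr|].
by exists (rnorm z) => x; exact: cauchy_schwarz.
Qed.

(* The representing vector minimizes [Q y = (rnorm y)^2 / 2 - g y]; minimizing
   sequences are Cauchy by the parallelogram identity
   [(rnorm (y - z))^2 = 4 (Q y + Q z - 2 Q ((y + z) / 2))]. *)
Lemma riesz g : banach X -> real_functional g -> exists z, forall y, g y = dot z y.
Proof.
move=> bX rg; have [M M0 gM] := rfun_bound rg.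
pose Q y := rnorm y ^+ 2 / 2 - g y.
have Qlb y : - (M ^+ 2 / 2) <= Q y.
  have := le_trans (ler_norm _) (gM y).
  by have := sqr_ge0 (rnorm y - M); rewrite /Q sqrrB; lra.
have hasinf : has_inf (range Q).
  by split; [exists (Q 0), 0|exists (- (M ^+ 2 / 2)) => _ [y _ <-]].
pose m := inf (range Q).
have mQ y : m <= Q y by apply: ge_inf; [case: hasinf|exists y].
have /choice[u uP] : forall k, exists y, Q y < m + k.+1%:R^-1.
  move=> k; have k0 : 0 < k.+1%:R^-1 :> R by rewrite invr_gt0.
  by have [_ [y _ <-] yk] := inf_adherent k0 hasinf; exists y.
have par y z : rnorm (y - z) ^+ 2 = 4 * (Q y + Q z - 2 * Q (2^-1 *r (y + z))).
  rewrite /Q (rfunZ rg) (rfunD rg) !dotE !dot_simp (dotC z y).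
  by field.
have [e e0|x ux] := banach_cvg (u := u) bX.
  (* By [par] the squared distance of two terms is below 4 times the sum of two errors, each less
     than [e ^+ 2 / 8]. *)
  have e8 : 0 < e ^+ 2 / 8 by rewrite divr_gt0 ?exprn_gt0.
  have /cvgrPdist_lt/(_ _ e8)[N _ NP] := @cvg_harmonic R.
  exists N => i j Ni Nj; rewrite -ltr_sqr ?nnegrE ?rnorm_ge0 ?ltW// par.
  have := NP i Ni; have := NP j Nj.
  rewrite /= !sub0r !normrN !ger0_norm ?harmonic_ge0// /harmonic.
  have := uP i; have := uP j; have := mQ (2^-1 *r (u i + u j)).
  move: (Q _) (Q (u i)) (Q (u j)) j.+1%:R^-1 i.+1%:R^-1 (e ^+ 2) => *; lra.
have Qx : Q x <= m.
  have rx : rnorm (u k) @[k --> \oo] --> rnorm x.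
    by apply: (cvg_dist_le _ ux) => k; exact: ler_rnorm_dist.
  have gx := cvg_rweak ux rg.
  have Qu : Q (u k) @[k --> \oo] --> Q x.
    by apply: cvgB gx; apply: cvgMl; exact: (cvgM rx rx).
  have mk : m + k.+1%:R^-1 @[k --> \oo] --> m + 0.
    by apply: cvgD; [exact: cvg_cst|exact: (@cvg_harmonic R)].
  by rewrite -[m]addr0; apply: (cvg_ler Qu mk) => k; exact: ltW.
exists x => y; apply/eqP; rewrite eq_sym -subr_eq0.
(* The minimum is compared with its value after the step [- a * c] along [y]. Since
   [c * dot y y = 1 - c], this comparison reads [a ^+ 2 * c * (1 + c) <= 0]; the 1 in [c] covers
   [y = 0]. *)
set a := dot x y - g y; pose c := (dot y y + 1)^-1.
have b0 : 0 <= dot y y by rewrite -dotE sqr_ge0.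
have c0 : 0 < c by rewrite invr_gt0 ltr_wpDl.
have cb : c * dot y y = 1 - c.
  by rewrite /c; field; rewrite gt_eqF// ltr_wpDl.
have := le_trans Qx (mQ (x + (- a * c) *r y)).
rewrite /Q (rfunD rg) (rfunZ rg) !dotE !dot_simp (dotC y x) => h.
have : a ^+ 2 * c * (1 + c) <= 0.
  have -> : a ^+ 2 * c * (1 + c) = 2 * a ^+ 2 * c - a ^+ 2 * c * (1 - c) by ring.
  by rewrite -cb /a in h *; nra.
rewrite pmulr_lle0; last by rewrite addr_gt0.
rewrite pmulr_lle0// => a2.
by have := sqr_ge0 a; rewrite -sqrf_eq0 eq_le a2 => ->.
Qed.

End RealDot.

Lemma hilbert_ultra_reflexive : hilbert X -> ultra_reflexive X.
Proof.
move=> /hilbert_real_dot[bX [dot rdot]] u M uM U ultraU.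
have [||h rh hU] := @ultra_functional R s X U (fun k => dot (u k)) M ultraU.
- by move=> k; exact: dot_functional.
- move=> k v; apply: le_trans (cauchy_schwarz rdot _ _) _.
  by rewrite ler_wpM2r ?rnorm_ge0.
have [x hx] := riesz rdot bX rh; exists x => g /(riesz rdot bX)[z gz].
have -> : g = dot z by exact/funext.
rewrite (dotC rdot z x) -hx; under eq_fun do rewrite (dotC rdot z); exact: hU.
Qed.

End Hilbert.

(** * Attainment along minimizing sequences *)

Section Attainment.
Context {R : realType} {s : scalar_kind}.
Local Notation K := (scalar_field R s).
Context {X : normedModType K}.
Implicit Types (u a b : nat -> X) (x y z : X) (A B C : set X) (phi : nat -> nat).

Definition attained A B := exists z : X * X, best_approx_pair A B z.

Lemma dist_has_inf A B : A !=set0 -> B !=set0 ->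
  has_inf [set rnorm (a - b) | a in A & b in B].
Proof.
move=> [a Aa] [b Bb]; split; first by exists (rnorm (a - b)), a => //; exists b.
by exists 0 => _ [x _ [y _ <-]]; exact: rnorm_ge0.
Qed.

Lemma dist_le A B x y : A x -> B y -> dist A B <= rnorm (x - y).
Proof.
move=> Ax By; apply: ge_inf; last by exists x => //; exists y.
by case: (@dist_has_inf A B) => //; [exists x|exists y].
Qed.

Lemma dist_ge A B c : A !=set0 -> B !=set0 ->
  (forall x y, A x -> B y -> c <= rnorm (x - y)) -> c <= dist A B.
Proof.
move=> A0 B0 cAB; apply: lb_le_inf; first by case: (dist_has_inf A0 B0).
by move=> _ [x Ax [y By <-]]; exact: cAB.
Qed.

Lemma dist_ge0 A B : A !=set0 -> B !=set0 -> 0 <= dist A B.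
Proof. by move=> A0 B0; apply: dist_ge => // x y _ _; exact: rnorm_ge0. Qed.

Lemma pdist_le x y B : B y -> pdist x B <= rnorm (x - y).
Proof. by move=> By; exact: dist_le. Qed.

Lemma pdist_ge x B c : B !=set0 ->
  (forall y, B y -> c <= rnorm (x - y)) -> c <= pdist x B.
Proof. by move=> B0 cB; apply: dist_ge => //; [exists x|move=> _ y -> /cB]. Qed.

Lemma pdist_ltP x B c : B !=set0 -> pdist x B < c ->
  exists2 y, B y & rnorm (x - y) < c.
Proof.
move=> B0 xc; apply: contrapT => nB.
suff : c <= pdist x B by rewrite leNgt xc.
apply: pdist_ge => // y By; rewrite leNgt; apply/negP => xy.
by apply: nB; exists y.
Qed.

Lemma pdist_lipschitz x y B : B !=set0 -> pdist x B <= rnorm (x - y) + pdist y B.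
Proof.
move=> B0; rewrite -lerBlDl; apply: pdist_ge => // b Bb; rewrite lerBlDl.
exact: le_trans (pdist_le x Bb) (rnorm_triangle _ _ _).
Qed.

Lemma minimizing_seq A B : A !=set0 -> B !=set0 ->
  exists a b, [/\ forall k, A (a k), forall k, B (b k) &
    forall k, rnorm (a k - b k) <= dist A B + k.+1%:R^-1].
Proof.
move=> A0 B0; have /choice[ab abP] : forall k, exists xy : X * X,
    [/\ A xy.1, B xy.2 & rnorm (xy.1 - xy.2) <= dist A B + k.+1%:R^-1].
  move=> k; have k0 : 0 < k.+1%:R^-1 :> R by rewrite invr_gt0.
  have [_ [x Ax [y By <-]] xy] := inf_adherent k0 (dist_has_inf A0 B0).
  by exists (x, y); split => //; exact: ltW.
by exists (fst \o ab), (snd \o ab); split => k; case: (abP k).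
Qed.

Lemma cvg_dist_harmonic (d : R) : d + k.+1%:R^-1 @[k --> \oo] --> d.
Proof.
rewrite -[X in _ --> X]addr0; apply: cvgD; first exact: cvg_cst.
exact: (@cvg_harmonic R).
Qed.

Arguments cvg_dist_harmonic : clear implicits.

Lemma minimizing_bound A B a b :
  (forall k, rnorm (a k - b k) <= dist A B + k.+1%:R^-1) ->
  forall k, rnorm (a k - b k) <= dist A B + 1.
Proof.
move=> abd k; apply: le_trans (abd k) _; rewrite lerD2l invf_le1 ?ltr0n//.
by rewrite ler1n.
Qed.

Lemma attained_le A B x y : A x -> B y -> rnorm (x - y) <= dist A B -> attained A B.
Proof.
move=> Ax By xy; exists (x, y); split => //=; apply/eqP.
by rewrite eq_le xy/= dist_le.
Qed.

Lemma attained_le_eps A B x y : A x -> B y ->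
  (forall e, 0 < e -> rnorm (x - y) <= dist A B + e) -> attained A B.
Proof.
move=> Ax By xy; apply: attained_le Ax By _; apply/ler_addgt0Pr => e e0.
exact: xy.
Qed.

(** The common last step of the weak arguments. The bound [d] is free because a prescribed
    minimizing sequence comes without a rate. *)
Lemma attained_weak A B a b phi z (d : nat -> R) :
  {homo phi : i j / (i < j)%N} ->
  (forall k, rnorm (a k - b k) <= d k) -> d k @[k --> \oo] --> dist A B ->
  rweak_cvg_to \oo (fun k => a (phi k) - b (phi k)) z -> mink_sub A B z ->
  attained A B.
Proof.
move=> phiI abd dd wz [x Ax [y By xyz]]; subst z.
apply: (attained_le Ax By); apply: (rweak_norm_le wz) (cvg_subseq phiI dd) => k.
exact: abd.
Qed.

(** Together with convexity of the sublevel sets, this makes [rweak_closed] apply: the distance to a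
    convex set is weakly lower semicontinuous. *)
Lemma pdist_sublevel_closed B d : B !=set0 -> nclosed [set x | pdist x B <= d].
Proof.
move=> B0 x xB /=; apply/ler_addgt0Pr => e e0; have [c cd xc] := xB e e0.
by apply: le_trans (pdist_lipschitz x c B0) _; rewrite addrC lerD// ltW.
Qed.

Lemma pdist_sublevel_convex B d : B !=set0 -> rconvex B ->
  rconvex [set x | pdist x B <= d].
Proof.
move=> B0 cB x y t t01 /= xd yd; apply/ler_addgt0Pr => e e0.
have [x' Bx' xx'] : exists2 x', B x' & rnorm (x - x') < d + e.
  by apply: pdist_ltP => //; rewrite (le_lt_trans xd)// ltrDl.
have [y' By' yy'] : exists2 y', B y' & rnorm (y - y') < d + e.
  by apply: pdist_ltP => //; rewrite (le_lt_trans yd)// ltrDl.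
apply: le_trans (pdist_le _ (cB _ _ _ t01 Bx' By')) _.
rewrite opprD addrACA -!rscaleBr (le_trans (ler_rnormD _ _))// !rnorm_rscale.
case/andP: t01 => t0 t1; have t1' : 0 <= 1 - t by rewrite subr_ge0.
rewrite !ger0_norm//.
have := ler_wpM2l t0 (ltW xx'); have := ler_wpM2l t1' (ltW yy'); lra.
Qed.

Lemma attained_rweak_compact_proximinal A B : A !=set0 -> B !=set0 ->
  rweak_compact A -> rconvex B -> proximinal B A -> attained A B.
Proof.
move=> A0 B0 cA cB pB; have [a [b [Aa Bb abd]]] := minimizing_seq A0 B0.
have [phi phiI [x Ax ax]] := cA a Aa; have [y By xy] := pB x Ax.
apply: (attained_le_eps Ax By) => e e0; rewrite -xy.
have /cvgrPdist_lt/(_ _ e0)[N _ NP] := @cvg_harmonic R.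
(* The first [N] terms are dropped, since [rweak_closed] wants every term in the sublevel set. *)
have shiftI : {homo addn N : i j / (i < j)%N} by move=> i j; rewrite ltn_add2l.
apply: (rweak_closed (@pdist_sublevel_closed B (dist A B + e) B0)
  (pdist_sublevel_convex B0 cB) _ (rweak_subseq shiftI ax)) => k /=.
apply: le_trans (pdist_le _ (Bb (phi (N + k)%N))) _; apply: le_trans (abd _) _.
rewrite lerD2l ltW//; have := NP (phi (N + k)%N).
rewrite sub0r normrN ger0_norm ?harmonic_ge0//; apply.
exact: leq_trans (leq_addr k N) (subseq_ge _ phiI).
Qed.

(** A minimizing sequence stays within [rho] of [b0]. Shrinking it towards [b0] by
    [t = r / (rho + r)] brings it into the compact ball without leaving the convex set [B]; the weak
    limit is then scaled back. *)
Lemma locally_rweak_compact_proximinal A B : B !=set0 -> nclosed B ->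
  rconvex B ->
  (forall x, B x -> exists2 r, 0 < r & rweak_compact (cball x r `&` B)) ->
  proximinal B A.
Proof.
move=> B0 clB cB lB x _; have [b0 Bb0] := B0; have [r r0 cr] := lB _ Bb0.
have [a [b [ax Bb abd]]] := @minimizing_seq [set x] B (ex_intro _ x erefl) B0.
pose rho := dist [set x] B + 1 + rnorm (x - b0).
have rho0 : 0 <= rho.
  by rewrite !addr_ge0 ?rnorm_ge0// dist_ge0//; exists x.
have b_le k : rnorm (b k - b0) <= rho.
  apply: le_trans (rnorm_triangle x _ _) _; rewrite rnorm_distC lerD2r.
  by have := minimizing_bound abd k; rewrite ax.
clearbody rho; have rr : 0 < rho + r by rewrite ltr_wpDl.
pose t := r / (rho + r); have t0 : 0 < t by rewrite divr_gt0.
have t01 : 0 <= t <= 1 by rewrite ltW//= ler_pdivrMr// mul1r lerDr.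
have [|phi phiI [y [_ By] yy]] := cr (fun k => t *r b k + (1 - t) *r b0).
  move=> k; split; last exact: cB.
  have -> : t *r b k + (1 - t) *r b0 = t *r (b k - b0) + b0.
    by rewrite rscaleBl rscale1 rscaleBr -addrA [_ + b0]addrC.
  rewrite /cball /closed_ball_ /= rnorm_distC addrK rnorm_rscale gtr0_norm//.
  have := ler_wpM2l (ltW t0) (b_le k) => /le_trans; apply.
  by rewrite /t mulrAC ler_pdivrMr// mulrDr lerDl mulr_ge0 ?ltW.
pose z := t^-1 *r (y - (1 - t) *r b0).
have bz : rweak_cvg_to \oo (b \o phi) z.
  have -> : b \o phi = fun k => t^-1 *r ((t *r b (phi k) + (1 - t) *r b0)
      - (1 - t) *r b0).
    by apply/funext => k; rewrite addrK rscaleA mulVf ?gt_eqF// rscale1.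
  by apply: rweakZ; apply: rweakB; [exact: yy|exact: rweak_cst].
have Bz : B z by apply: rweak_closed clB cB _ bz => k; exact: Bb.
exists z => //; apply/eqP; rewrite eq_le (pdist_le _ Bz)/=.
have xz : rweak_cvg_to \oo (fun k => x - b (phi k)) (x - z).
  by apply: rweakB; [exact: rweak_cst|exact: bz].
have lim := cvg_subseq phiI (cvg_dist_harmonic (pdist x B)).
apply: (rweak_norm_le xz _ lim) => k.
by have := abd (phi k); rewrite ax.
Qed.

(** Norm convergence of [a] replaces convexity of [B]: the distance to any set is 1-Lipschitz. *)
Lemma attained_norm_cvg_proximinal A B a b phi x : B !=set0 ->
  (forall k, A (a k)) -> (forall k, B (b k)) ->
  (forall k, rnorm (a k - b k) <= dist A B + k.+1%:R^-1) ->
  {homo phi : i j / (i < j)%N} ->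
  rnorm (a (phi k) - x) @[k --> \oo] --> (0 : R) -> A x ->
  proximinal B A -> attained A B.
Proof.
move=> B0 Aa Bb abd phiI ax Ax pB; have [y By xy] := pB x Ax.
apply: (attained_le Ax By); rewrite -xy.
have lim : rnorm (a (phi k) - x) + (dist A B + (phi k).+1%:R^-1)
    @[k --> \oo] --> 0 + dist A B.
  by apply: cvgD => //; exact: cvg_subseq phiI (cvg_dist_harmonic _).
rewrite add0r in lim; apply: (cvg_ler (cvg_cst (pdist x B)) lim) => k.
apply: le_trans (pdist_lipschitz x (a (phi k)) B0) _.
rewrite rnorm_distC lerD2l; apply: le_trans (abd _); exact: pdist_le.
Qed.

Lemma attained_compact_proximinal A B : A !=set0 -> B !=set0 ->
  compact A -> proximinal B A -> attained A B.
Proof.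
move=> A0 B0 cA pB; have [a [b [Aa Bb abd]]] := minimizing_seq A0 B0.
have [phi phiI [x Ax ax]] := compact_subseq cA Aa.
exact: attained_norm_cvg_proximinal ax Ax pB.
Qed.

Lemma boundedly_compact_subseq C u (M : R) : boundedly_compact C ->
  (forall k, C (u k)) -> (forall k, rnorm (u k) <= M) ->
  exists2 phi : nat -> nat, {homo phi : i j / (i < j)%N} &
    exists2 x, C x & rnorm (u (phi k) - x) @[k --> \oo] --> (0 : R).
Proof.
move=> cC Cu uM; have M0 : 0 <= M := le_trans (rnorm_ge0 _) (uM 0).
have M1 : 0 < M + 1 by rewrite ltr_wpDl.
have [|phi phiI [x [_ Cx] ux]] := compact_subseq (cC 0 (M + 1) M1) (u := u).
  move=> k; split => //; rewrite /cball /closed_ball_ /= sub0r rnormN.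
  by rewrite (le_trans (uM k))// lerDl.
by exists phi => //; exists x.
Qed.

Lemma attained_boundedly_compact_proximinal A B : A !=set0 -> B !=set0 ->
  boundedly_compact A -> bounded_set B -> proximinal B A -> attained A B.
Proof.
move=> A0 B0 cA /bounded_set_rnorm[M BM] pB.
have [a [b [Aa Bb abd]]] := minimizing_seq A0 B0.
have [k|phi phiI [x Ax ax]] :=
    @boundedly_compact_subseq A a (dist A B + 1 + M) cA Aa.
  rewrite -[a k](subrK (b k)) (le_trans (ler_rnormD _ _))// lerD ?BM//.
  exact: minimizing_bound abd k.
exact: attained_norm_cvg_proximinal ax Ax pB.
Qed.

Lemma attained_boundedly_compact A B : A !=set0 -> B !=set0 ->
  boundedly_compact A -> boundedly_compact B ->
  bounded_set A \/ bounded_set B -> attained A B.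
Proof.
move=> A0 B0 cA cB bAB; have [a [b [Aa Bb abd]]] := minimizing_seq A0 B0.
have abM := minimizing_bound abd.
have [M aM bM] : exists2 M, forall k, rnorm (a k) <= M & forall k, rnorm (b k) <= M.
  have d0 := dist_ge0 A0 B0.
  case: bAB => /bounded_set_rnorm[M MP]; exists (M + (dist A B + 1)) => k.
  - by rewrite (le_trans (MP _ (Aa k)))// lerDl addr_ge0.
  - rewrite -[b k](subKr (a k)) (le_trans (ler_rnormB _ _))// lerD//.
    exact: MP.
  - rewrite -[a k](subrK (b k)) addrC (le_trans (ler_rnormD _ _))// lerD//.
    exact: MP.
  - by rewrite (le_trans (MP _ (Bb k)))// lerDl addr_ge0.
have [phi phiI [x Ax ax]] := boundedly_compact_subseq cA Aa aM.
have [psi psiI [y By bY]] := @boundedly_compact_subseq B (b \o phi) M cB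
  (fun k => Bb (phi k)) (fun k => bM (phi k)).
apply: (attained_weak (subseq_comp phiI psiI) abd (cvg_dist_harmonic _)).
  exact: rweakB (rweak_subseq psiI (cvg_rweak ax)) (cvg_rweak bY).
by exists x => //; exists y.
Qed.

Lemma attained_rweak_compact A B : A !=set0 -> B !=set0 ->
  rweak_compact A -> rweak_compact B -> attained A B.
Proof.
move=> A0 B0 cA cB; have [a [b [Aa Bb abd]]] := minimizing_seq A0 B0.
have [phi phiI [x Ax ax]] := cA a Aa.
have [psi psiI [y By bY]] := cB (b \o phi) (fun k => Bb (phi k)).
apply: (attained_weak (subseq_comp phiI psiI) abd (cvg_dist_harmonic _)).
  exact: rweakB (rweak_subseq psiI ax) bY.
by exists x => //; exists y.
Qed.

Lemma ler_pair_norm x y : rnorm x <= pair_norm (x, y) /\ rnorm y <= pair_norm (x, y).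
Proof.
rewrite /pair_norm /=; split.
  rewrite -{1}(ger0_norm (rnorm_ge0 x)) -sqrtr_sqr.
  by rewrite ler_sqrt ?addr_ge0 ?sqr_ge0// lerDl sqr_ge0.
rewrite -{1}(ger0_norm (rnorm_ge0 y)) -sqrtr_sqr.
by rewrite ler_sqrt ?addr_ge0 ?sqr_ge0// lerDr sqr_ge0.
Qed.

Lemma pair_norm_le x y : pair_norm (x, y) <= rnorm x + rnorm y.
Proof.
have x0 := rnorm_ge0 x; have y0 := rnorm_ge0 y.
rewrite /pair_norm /= -[leRHS]ger0_norm ?addr_ge0// -sqrtr_sqr.
by rewrite ler_sqrt ?sqr_ge0// sqrrD -addrA lerD2l lerDr mulrn_wge0 ?mulr_ge0.
Qed.

Lemma coercive_bound A B (d : R) : coercive_diff A B ->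
  exists M, forall x y, A x -> B y -> rnorm (x - y) <= d ->
    rnorm x <= M /\ rnorm y <= M.
Proof.
move=> /(_ (d + 1))[N NP]; exists N => x y Ax By xyd.
suff xyN : pair_norm (x, y) < N.
  by have [xN yN] := ler_pair_norm x y; rewrite !ltW// (le_lt_trans _ xyN).
rewrite ltNge; apply/negP => /(NP (x, y) (conj Ax By)) /=.
by rewrite leNgt (le_lt_trans xyd)// ltrDl.
Qed.

Lemma bounded_or_coercive_bound A B (d : R) :
  bounded_set (A `|` B) \/ (~ bounded_set (A `|` B) /\ coercive_diff A B) ->
  exists M, forall x y, A x -> B y -> rnorm (x - y) <= d ->
    rnorm x <= M /\ rnorm y <= M.
Proof.
case=> [/bounded_set_rnorm[M ABM]|[_]]; last exact: coercive_bound.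
by exists M => x y Ax By _; split; apply: ABM; [left|right].
Qed.

Lemma attained_product A B : A !=set0 -> B !=set0 ->
  (forall r : R, 0 < r ->
     weakly_seq_compact ([set z | pair_norm z <= r] `&` (A `*` B))) ->
  (forall d : R, exists M, forall x y, A x -> B y -> rnorm (x - y) <= d ->
    rnorm x <= M /\ rnorm y <= M) -> attained A B.
Proof.
move=> A0 B0 cAB bAB; have [a [b [Aa Bb abd]]] := minimizing_seq A0 B0.
have [M abM] := bAB (dist A B + 1).
have {}abM k := abM _ _ (Aa k) (Bb k) (minimizing_bound abd k).
have M0 : 0 <= M := le_trans (rnorm_ge0 _) (abM 0).1.
have M1 : 0 < M + M + 1 by rewrite ltr_wpDl ?addr_ge0.
have [|phi phiI [z [_ [Az Bz]] abz]] :=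
    weakly_seq_compactP (cAB _ M1) (u := fun k => (a k, b k)).
  move=> k; split => //=; apply: le_trans (pair_norm_le _ _) _.
  by have [ak bk] := abM k; rewrite (le_trans (lerD ak bk))// lerDl.
have [az bz] := rweak_pair abz.
apply: (attained_weak phiI abd (cvg_dist_harmonic _) (rweakB az bz)).
by exists z.1 => //; exists z.2.
Qed.

Section BoundedWeakSubseq.
Hypothesis bws : bounded_weak_subseq X.

Lemma attained_bounded_subseq A B a b (d : nat -> R) phi (M : R) :
  weakly_seq_closed A -> weakly_seq_closed B ->
  (forall k, A (a k)) -> (forall k, B (b k)) ->
  (forall k, rnorm (a k - b k) <= d k) -> d k @[k --> \oo] --> dist A B ->
  {homo phi : i j / (i < j)%N} -> (forall k, rnorm (a (phi k)) <= M) ->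
  (forall k, rnorm (a (phi k) - b (phi k)) <= M) ->
  attained A B.
Proof.
move=> clA clB Aa Bb abd dd phiI aM abM.
have [psi psiI [x ax]] := bws aM.
have [|chi chiI [z wz]] := bws (u := fun k => a (phi (psi k)) - b (phi (psi k))) (M := M).
  by move=> k; exact: abM.
have ax' := rweak_subseq chiI ax.
(* The limit of [b] comes from [b = a - (a - b)], without a third extraction. *)
have bz : rweak_cvg_to \oo (b \o (phi \o (psi \o chi))) (x - z).
  have -> : b \o (phi \o (psi \o chi)) = fun k => a (phi (psi (chi k))) -
      (a (phi (psi (chi k))) - b (phi (psi (chi k)))).
    by apply/funext => k /=; rewrite subKr.
  exact: rweakB ax' wz.
apply: (attained_weak (subseq_comp phiI (subseq_comp psiI chiI)) abd dd
  (rweakB ax' bz)).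
exists x; first by apply: weakly_seq_closedP clA _ _ _ ax' => k; exact: Aa.
by exists (x - z) => //; apply: weakly_seq_closedP clB _ _ _ bz => k; exact: Bb.
Qed.

Lemma attained_bounded_pairs A B : A !=set0 -> B !=set0 ->
  weakly_seq_closed A -> weakly_seq_closed B ->
  (forall d : R, exists M, forall x y, A x -> B y -> rnorm (x - y) <= d ->
    rnorm x <= M /\ rnorm y <= M) -> attained A B.
Proof.
move=> A0 B0 clA clB bAB; have [a [b [Aa Bb abd]]] := minimizing_seq A0 B0.
have [M abM] := bAB (dist A B + 1).
have d0 := dist_ge0 A0 B0.
have {}abM k := abM _ _ (Aa k) (Bb k) (minimizing_bound abd k).
have M0 : 0 <= M := le_trans (rnorm_ge0 _) (abM 0).1.
apply: (@attained_bounded_subseq _ _ a b _ id (M + (dist A B + 1)) clA clB Aa Bb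
  abd (cvg_dist_harmonic _)) => // k.
  by rewrite (le_trans (abM k).1)// lerDl addr_ge0.
by rewrite (le_trans (minimizing_bound abd k))// lerDr.
Qed.

Lemma attained_bounded A B : A !=set0 -> B !=set0 -> bounded_set A ->
  weakly_seq_closed A -> weakly_seq_closed B -> attained A B.
Proof.
move=> A0 B0 /bounded_set_rnorm[M AM] clA clB.
apply: attained_bounded_pairs => // d; exists (M + `|d|) => x y Ax By xyd.
have xM := AM _ Ax; split; first by rewrite (le_trans xM)// lerDl.
rewrite -[y](subKr x) (le_trans (ler_rnormB _ _))// lerD//.
exact: le_trans xyd (ler_norm _).
Qed.

(* With [w = a - b] bounded along a minimizing sequence, the convergence of the
   compact parts forces that of the remaining ones: no bound on the latter
   is needed. *)
Lemma attained_mink_add At Ah Bt Bh :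
  mink_add At Ah !=set0 -> mink_add Bt Bh !=set0 ->
  rweak_compact At -> rweak_compact Bt -> weakly_seq_closed (mink_sub Ah Bh) ->
  attained (mink_add At Ah) (mink_add Bt Bh).
Proof.
move=> A0 B0 cA cB clAB; have [a [b [Aa Bb abd]]] := minimizing_seq A0 B0.
have /choice[a2 a2P] : forall k, exists p : X * X,
    [/\ At p.1, Ah p.2 & p.1 + p.2 = a k].
  by move=> k; have [x Ax [y Ay xy]] := Aa k; exists (x, y).
have /choice[b2 b2P] : forall k, exists p : X * X,
    [/\ Bt p.1, Bh p.2 & p.1 + p.2 = b k].
  by move=> k; have [x Ax [y Ay xy]] := Bb k; exists (x, y).
have [phi phiI [x Ax ax]] := cA (fst \o a2) (fun k => let: And3 h _ _ := a2P k in h).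
have [psi psiI [y By bY]] := cB (fst \o b2 \o phi)
  (fun k => let: And3 h _ _ := b2P (phi k) in h).
have [|chi chiI [w ww]] := bws (u := fun k => a (phi (psi k)) - b (phi (psi k)))
    (M := dist (mink_add At Ah) (mink_add Bt Bh) + 1).
  by move=> k; exact: (minimizing_bound abd).
have ax' := rweak_subseq chiI (rweak_subseq psiI ax).
have bY' := rweak_subseq chiI bY.
have clw : mink_sub Ah Bh (w - x + y).
  apply: (weakly_seq_closedP clAB _ (rweakD (rweakB ww ax') bY')) => k /=.
  set j := phi _; have [_ Aj aj] := a2P j; have [_ Bj bj] := b2P j.
  exists (a2 j).2 => //; exists (b2 j).2 => //.
  rewrite -aj -bj [(a2 j).1 + _]addrC [(b2 j).1 + _]addrC opprD addrA.
  by rewrite (addrAC _ (- (a2 j).1) (b2 j).1) subrK addrAC addrK.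
have [x' Ax' [y' By' xy']] := clw.
apply: (attained_weak (subseq_comp phiI (subseq_comp psiI chiI)) abd
  (cvg_dist_harmonic _) ww).
exists (x + x'); first by exists x => //; exists x'.
exists (y + y'); first by exists y => //; exists y'.
by rewrite opprD addrACA xy' addrC addrA addrAC addrK subrK.
Qed.

Lemma attained_mink_sub_closed A B : A !=set0 -> B !=set0 ->
  weakly_seq_closed (mink_sub A B) -> attained A B.
Proof.
move=> A0 B0 clAB; have [a [b [Aa Bb abd]]] := minimizing_seq A0 B0.
have [phi phiI [w ww]] := bws (minimizing_bound abd).
apply: (attained_weak phiI abd (cvg_dist_harmonic _) ww).
apply: (weakly_seq_closedP clAB _ ww) => k /=.
by exists (a (phi k)) => //; exists (b (phi k)).
Qed.

(** Only [a - b] has to be bounded, so the boundedness of weakly compact sets, a case of the uniform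
    boundedness principle, is avoided. *)
Lemma attained_rweak_compact_closed A B : A !=set0 -> B !=set0 ->
  rweak_compact A -> weakly_seq_closed B -> attained A B.
Proof.
move=> A0 B0 cA clB; have [a [b [Aa Bb abd]]] := minimizing_seq A0 B0.
have [phi phiI [x Ax ax]] := cA a Aa.
have [|psi psiI [w ww]] := bws (u := fun k => a (phi k) - b (phi k)) (M := dist A B + 1).
  by move=> k; exact: (minimizing_bound abd).
have bz : rweak_cvg_to \oo (b \o (phi \o psi)) (x - w).
  have -> : b \o (phi \o psi) = fun k => a (phi (psi k)) -
      (a (phi (psi k)) - b (phi (psi k))).
    by apply/funext => k /=; rewrite subKr.
  exact: rweakB (rweak_subseq psiI ax) ww.
apply: (attained_weak (subseq_comp phiI psiI) abd (cvg_dist_harmonic _) ww).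
exists x => //; exists (x - w); last by rewrite subKr.
by apply: (weakly_seq_closedP clB _ bz) => k /=.
Qed.

End BoundedWeakSubseq.

Lemma mink_sub_convex A B : rconvex A -> rconvex B -> rconvex (mink_sub A B).
Proof.
move=> cA cB _ _ t t01 [x Ax [y By <-]] [x' Ax' [y' By' <-]].
exists (t *r x + (1 - t) *r x'); first exact: cA.
exists (t *r y + (1 - t) *r y'); first exact: cB.
by rewrite !rscaleBr opprD addrACA.
Qed.

End Attainment.
Arguments cvg_dist_harmonic : clear implicits.
Arguments cvg_dist_harmonic {R} d.

(** * Finite-dimensional and affine sets *)

Section FiniteDimension.
Context {R : realType} {s : scalar_kind}.
Local Notation K := (scalar_field R s).
Context {X : normedModType K}.
Implicit Types (u : nat -> X) (x y z w : X) (L M A B C : set X) (ws : seq X).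

Definition add_line L w : set X := [set x | exists2 y, L y & exists t, x = y + t *r w].

(** The real span of [L] and [ws], built line by line so that closedness, compactness and dimension
    arguments become inductions on the list. *)
Fixpoint span_over L ws : set X :=
  if ws is w :: ws' then add_line (span_over L ws') w else L.

Lemma sub_add_line L w : L `<=` add_line L w.
Proof. by move=> x Lx; exists x => //; exists 0; rewrite rscale0l addr0. Qed.

Lemma add_line_rsubspace L w : rsubspace L -> rsubspace (add_line L w).
Proof.
move=> sL; split; first exact: sub_add_line sL.1.
move=> t _ _ [x Lx [a ->]] [y Ly [b ->]]; exists (t *r x + y).
  by case: sL => _; apply.
by exists (t * a + b); rewrite rscaleDr rscaleDl rscaleA addrACA.
Qed.

Lemma span_over_rsubspace L ws : rsubspace L -> rsubspace (span_over L ws).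
Proof. by move=> sL; elim: ws => //= w ws; exact: add_line_rsubspace. Qed.

Lemma sub_span_over L ws : L `<=` span_over L ws.
Proof. by elim: ws => //= w ws IH x /IH; exact: sub_add_line. Qed.

Lemma span_over_mono L M ws : L `<=` M -> span_over L ws `<=` span_over M ws.
Proof.
move=> LM; elim: ws => //= w ws IH x [y /IH Ly [t ->]].
by exists y => //; exists t.
Qed.

Lemma mem_span_over L ws w : rsubspace L -> w \in ws -> span_over L ws w.
Proof.
move=> sL; elim: ws => // v ws IH; rewrite inE => /orP[/eqP ->|/IH]; last first.
  exact: sub_add_line.
exists 0; last by exists 1; rewrite rscale1 add0r.
exact: sub_span_over sL.1.
Qed.

Lemma span_over_min L M ws : rsubspace M -> L `<=` M ->
  (forall w, w \in ws -> M w) -> span_over L ws `<=` M.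
Proof.
move=> sM LM; elim: ws => //= w ws IH wsM x [y Ly [t ->]]; apply: rsubspaceD => //.
  by apply: IH Ly => v vws; apply: wsM; rewrite inE vws orbT.
by apply: rsubspaceZ => //; apply: wsM; rewrite mem_head.
Qed.

Lemma mink_add_span L ws :
  mink_add L (span_over [set 0] ws) = span_over L ws.
Proof.
elim: ws => [|w ws IH] /=; apply/seteqP; split => x.
- by move=> [y Ly [_ -> <-]]; rewrite addr0.
- by move=> Lx; exists x => //; exists 0; rewrite ?addr0.
- move=> [y Ly [_ [z zs [t ->]] <-]]; exists (y + z).
    by rewrite -IH; exists y => //; exists z.
  by exists t; rewrite addrA.
- move=> [y]; rewrite -IH => -[l Ll [z zs <-]] [t ->]; exists l => //.
  exists (z + t *r w); last by rewrite addrA.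
  by exists z => //; exists t.
Qed.

Lemma add_line_mem L w : rsubspace L -> L w -> add_line L w = L.
Proof.
move=> sL Lw; apply/seteqP; split; last exact: sub_add_line.
by move=> _ [y Ly [t ->]]; apply: rsubspaceD => //; exact: rsubspaceZ.
Qed.

(* A real functional vanishing on [L] with value 1 at [w] reads off the
   coefficient of [w]. *)
Lemma add_line_closed L w : rsubspace L -> nclosed L -> nclosed (add_line L w).
Proof.
move=> sL clL; have [Lw|nLw] := pselect (L w); first by rewrite add_line_mem.
have [g [rg gL gw]] := annihilator sL clL nLw; have [M M0 gM] := rfun_bound rg.
move=> x xL; exists (x - g x *r w); last by exists (g x); rewrite subrK.
(* Removing the [w]-component is Lipschitz with this constant, so points of [add_line L w] near [x]
   yield points of [L] near [x - g x *r w]. *)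
apply: clL => e e0; have D0 : 0 < 1 + M * rnorm w.
  by rewrite ltr_pwDl// mulr_ge0 ?rnorm_ge0// ltW.
have [c [y Ly [t ->]] xy] := xL _ (divr_gt0 e0 D0); exists y => //.
have gt : g (y + t *r w) = t by rewrite (rfunD rg) (rfunZ rg) gL// gw add0r mulr1.
have -> : x - g x *r w - y = x - (y + t *r w) - g (x - (y + t *r w)) *r w.
  by rewrite (rfunB rg) gt rscaleBl opprB opprD !addrA subrK addrAC.
apply: le_lt_trans (ler_rnormB _ _) _; rewrite rnorm_rscale.
move: xy; rewrite ltr_pdivlMr// mulrDr mulr1; apply: le_lt_trans.
rewrite lerD2l mulrA (mulrC _ M) ler_wpM2r ?rnorm_ge0//; exact: gM.
Qed.

Lemma span_over_closed L ws : rsubspace L -> nclosed L -> nclosed (span_over L ws).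
Proof.
move=> sL clL; elim: ws => //= w ws IH.
by apply: add_line_closed => //; exact: span_over_rsubspace.
Qed.

Definition bounded_subseq L := forall u (M : R), (forall k, L (u k)) ->
  (forall k, rnorm (u k) <= M) ->
  exists2 phi : nat -> nat, {homo phi : i j / (i < j)%N} &
    exists2 x, L x & rnorm (u (phi k) - x) @[k --> \oo] --> (0 : R).

Lemma real_bounded_subseq (v : nat -> R) (M : R) : (forall k, `|v k| <= M) ->
  exists2 phi : nat -> nat, {homo phi : i j / (i < j)%N} &
    exists l, `|v (phi k) - l| @[k --> \oo] --> (0 : R).
Proof.
move=> vM; have [|phi phiI /cvg_ex[l vl]] := @bolzano_weierstrass R v.
  by exists M; split; [exact: num_real|move=> x Mx k _; exact: le_trans (vM k) (ltW Mx)].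
exists phi; last by exists l; exact: cvg0_dist.
by move=> i j ij; exact: etrans (leW_mono phiI i j) ij.
Qed.

(** The coefficient of [w] is read off by a bounded functional, so it is a bounded real sequence,
    and what remains is bounded in [L]. *)
Lemma add_line_bounded_subseq L w : rsubspace L -> nclosed L ->
  bounded_subseq L -> bounded_subseq (add_line L w).
Proof.
move=> sL clL cL; have [Lw|nLw] := pselect (L w); first by rewrite add_line_mem.
have [g [rg gL gw]] := annihilator sL clL nLw; have [N N0 gN] := rfun_bound rg.
move=> u M uL uM.
have guM k : `|g (u k)| <= N * M.
  by apply: le_trans (gN _) _; rewrite ler_pM2l.
have [phi phiI [l gl]] := real_bounded_subseq guM.
have yL k : L (u k - g (u k) *r w).
  have [y Ly [t ->]] := uL k.
  by rewrite (rfunD rg) (rfunZ rg) gL// gw add0r mulr1 addrK.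
have [|psi psiI [y Ly uy]] := cL (fun k => u (phi k) - g (u (phi k)) *r w)
    (M + N * M * rnorm w) (fun k => yL (phi k)).
  move=> k; apply: le_trans (ler_rnormB _ _) _; rewrite rnorm_rscale lerD//.
  by rewrite ler_wpM2r ?rnorm_ge0.
exists (phi \o psi); first exact: subseq_comp.
exists (y + l *r w); first by exists y => //; exists l.
have glw : rnorm w * `|g (u (phi (psi k))) - l| @[k --> \oo] --> (0 : R).
  exact: cvg0Ml (cvg_subseq psiI gl).
apply: (cvg0_le _ (cvg0D uy glw)) => k; rewrite rnorm_ge0/=.
have -> : u (phi (psi k)) - (y + l *r w) = u (phi (psi k)) -
    g (u (phi (psi k))) *r w - y + (g (u (phi (psi k))) - l) *r w.
  by rewrite rscaleBl opprD !addrA (addrAC _ (- y) (g _ *r w)) subrK.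
by rewrite mulrC -rnorm_rscale ler_rnormD.
Qed.

Lemma rsubspace0 : rsubspace [set 0 : X].
Proof. by split => // t _ _ -> ->; rewrite /= rscale0r addr0. Qed.

Lemma nclosed0 : nclosed [set 0 : X].
Proof.
move=> x x0 /=; apply/rnorm0_eq0/eqP; rewrite eq_le rnorm_ge0 andbT.
apply/ler_addgt0Pr => e e0; rewrite add0r.
by have [_ -> /ltW] := x0 e e0; rewrite subr0.
Qed.

Lemma span_bounded_subseq ws : bounded_subseq (span_over [set 0] ws).
Proof.
elim: ws => [|w ws IH].
  move=> u M u0 _; exists id => //; exists 0 => //.
  have -> : (fun k => rnorm (u k - 0)) = fun=> 0 by apply/funext => k;
    rewrite u0 subr0 rnorm0.
  exact: cvg_cst.
apply: add_line_bounded_subseq => //.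
- exact: span_over_rsubspace rsubspace0.
- exact: span_over_closed rsubspace0 nclosed0.
Qed.

Lemma has_dim_span L n : has_dim L n -> exists ws, L = span_over [set 0] ws.
Proof.
move=> [e [_ ->]].
(* A complex line is spanned over the reals by [e i] and [sI *: e i]; for real scalars the second
   list consists of zeros. *)
exists ([seq e i | i <- enum 'I_n] ++ [seq sI *: e i | i <- enum 'I_n]).
set ws := _ ++ _; set S := span_over _ _; set L' := (X in X = _).
have sS : rsubspace S by exact: span_over_rsubspace rsubspace0.
have sL : rsubspace L'.
  split; first by exists (fun=> 0) => //; rewrite big1// => i _; rewrite scale0r.
  move=> t _ _ [c _ <-] [d _ <-]; exists (fun i => sreal t * c i + d i) => //.
  rewrite /rscale scaler_sumr -big_split/=; apply: eq_bigr => i _.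
  by rewrite scalerDl scalerA.
have eL i a : L' (a *: e i).
  exists (fun j => if j == i then a else 0) => //.
  rewrite (bigD1 i)//= eqxx big1 ?addr0// => j /negbTE ->; exact: scale0r.
apply/seteqP; split.
  move=> _ [c _ <-]; apply: (big_ind S); first exact: sS.1.
    by move=> x y; exact: rsubspaceD.
  move=> i _; rewrite [c i]scalarE scalerDl -scalerA; apply: rsubspaceD => //.
    apply: (@rsubspaceZ _ _ _ S (sre (c i))) => //.
    apply: mem_span_over; first exact: rsubspace0.
    by rewrite mem_cat (map_f e) ?mem_enum.
  apply: (@rsubspaceZ _ _ _ S (sim (c i))) => //.
  apply: mem_span_over; first exact: rsubspace0.
  by rewrite mem_cat (map_f (fun i => sI *: e i)) ?mem_enum ?orbT.
apply: span_over_min => //; first by move=> _ ->; exact: sL.1.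
move=> w; rewrite mem_cat => /orP[] /mapP[i _ ->]; last exact: eL.
by rewrite -[e i]scale1r.
Qed.

Lemma finite_dim_span L : finite_dim L -> exists ws, L = span_over [set 0] ws.
Proof. by move=> [n]; exact: has_dim_span. Qed.

(** Steinitz exchange: some vector of [ws] has a nonzero coefficient in [w] and can be expressed by
    [w] and the others. *)
Lemma span_over_exchange L ws w : rsubspace L -> span_over L ws w -> ~ L w ->
  exists2 vs, (size vs < size ws)%N &
    span_over L ws `<=` span_over (add_line L w) vs.
Proof.
move=> sL; have sLw := add_line_rsubspace w sL.
elim: ws => [|v ws IH] //= [y Ly [t wE]] nLw.
have [t0|t0] := eqVneq t 0.
  have [|vs vsz vsP] := IH _ nLw; first by rewrite wE t0 rscale0l addr0.
  by exists (v :: vs) => //= x [z /vsP Lz [a ->]]; exists z => //; exists a.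
exists ws => //; have sS := span_over_rsubspace ws sLw.
have LS : span_over L ws `<=` span_over (add_line L w) ws.
  by apply: span_over_mono; exact: sub_add_line.
apply: (@span_over_min _ _ [:: v]) => // x; rewrite inE => /eqP ->.
have -> : v = t^-1 *r (w - y).
  by rewrite wE addrAC subrr add0r rscaleA mulVf// rscale1.
apply: rsubspaceZ => //; apply: rsubspaceB => //; last exact: LS.
apply: sub_span_over; exists 0; first exact: sL.1.
by exists 1; rewrite rscale1 add0r.
Qed.

(** As long as [M] is larger than [L], one of its vectors is added to [L]. This keeps [L] closed
    and, by exchange, shortens the list still needed to span the space. *)
Lemma finite_codim_closed L M ws : rsubspace L -> nclosed L ->
  span_over L ws = setT -> rsubspace M -> L `<=` M -> nclosed M.
Proof.
move: {2}(size ws).+1 (ltnSn (size ws)) => n.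
elim: n L ws => // n IH L ws wsn sL clL LT sM LM.
have [ML|/existsNP[w /not_implyP[Mw nLw]]] := pselect (M `<=` L).
  by have -> : M = L by apply/seteqP.
have [|vs vsz vsP] := span_over_exchange sL _ nLw (ws := ws); first by rewrite LT.
apply: (IH (add_line L w) vs) => //.
- by rewrite (leq_trans vsz).
- exact: add_line_rsubspace.
- exact: add_line_closed.
- by apply/seteqP; split => // x _; apply: vsP; rewrite LT.
- by move=> _ [y /LM My [t ->]]; apply: rsubspaceD => //; exact: rsubspaceZ.
Qed.

End FiniteDimension.

Section Affine.
Context {R : realType} {s : scalar_kind}.
Local Notation K := (scalar_field R s).
Context {X : normedModType K}.
Implicit Types (u : nat -> X) (x y z w : X) (L M A B C : set X) (ws : seq X).

Lemma nclosed_shift C w : nclosed C -> nclosed [set x | C (x - w)].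
Proof.
move=> clC x xC; apply: clC => e e0; have [c cC xc] := xC e e0.
by exists (c - w) => //; rewrite opprB addrA subrK.
Qed.

Lemma rconvex_shift C w : rconvex C -> rconvex [set x | C (x - w)].
Proof.
move=> cC x y t t01 Cx Cy /=; have := cC _ _ _ t01 Cx Cy.
rewrite !rscaleBr addrACA -opprD -(rscaleDl t (1 - t) w).
by rewrite [t + _]addrC subrK rscale1.
Qed.

Lemma mink_addC A B : mink_add A B = mink_add B A.
Proof.
by apply/seteqP; split => _ [x Ax [y By <-]]; exists y => //; exists x => //;
  rewrite addrC.
Qed.

Lemma mink_add_rsubspace L M : rsubspace L -> rsubspace M ->
  rsubspace (mink_add L M).
Proof.
move=> [L0 sL] [M0 sM]; split; first by exists 0 => //; exists 0 => //; rewrite addr0.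
move=> t _ _ [x Lx [y My <-]] [x' Lx' [y' My' <-]].
exists (t *r x + x'); first exact: sL.
by exists (t *r y + y'); [exact: sM|rewrite rscaleDr addrACA].
Qed.

Lemma linear_part_nclosed A L : closed A -> has_linear_part A L -> nclosed L.
Proof.
move=> /closed_nclosed clA [_ [u Au]] x xL.
suff : A (u + x) by rewrite Au => -[_ -> [y Ly /addrI <-]].
apply: clA => e e0; have [c Lc xc] := xL e e0.
exists (u + c); first by rewrite Au; exists u => //; exists c.
by rewrite opprD addrACA subrr add0r.
Qed.

Lemma affine_mink_sub A B At Bt : has_linear_part A At -> has_linear_part B Bt ->
  exists w, mink_sub A B = [set x | mink_add At Bt (x - w)].
Proof.
move=> [_ [u ->]] [sB [v ->]]; exists (u - v).
have {}sB := linear_rsubspace sB.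
apply/seteqP; split.
  move=> _ [_ [_ -> [x Ax <-]] [_ [_ -> [y By <-]] <-]] /=.
  exists x => //; exists (- y); first exact: rsubspaceN.
  by rewrite opprD addrACA [RHS]addrC addKr.
move=> z /= [x Ax [y By xyz]]; exists (u + x); first by exists u => //; exists x.
exists (v - y); first by exists v => //; exists (- y) => //; exact: rsubspaceN.
by rewrite opprB [y - v]addrC addrACA xyz addrC subrK.
Qed.

Lemma attained_convex_mink_sub A B : bounded_weak_subseq X ->
  A !=set0 -> B !=set0 -> nclosed (mink_sub A B) -> rconvex (mink_sub A B) ->
  attained A B.
Proof.
move=> bws A0 B0 clAB cAB; apply: attained_mink_sub_closed => //.
exact: convex_weakly_seq_closed.
Qed.

Lemma attained_affine A B At Bt : bounded_weak_subseq X ->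
  A !=set0 -> B !=set0 -> has_linear_part A At -> has_linear_part B Bt ->
  nclosed (mink_add At Bt) -> attained A B.
Proof.
move=> bws A0 B0 AAt BBt clAB; have [w AB] := affine_mink_sub AAt BBt.
have sA := linear_rsubspace AAt.1; have sB := linear_rsubspace BBt.1.
apply: attained_convex_mink_sub => //; rewrite AB; first exact: nclosed_shift.
exact: rconvex_shift (rsubspace_convex (mink_add_rsubspace sA sB)).
Qed.

(** Only the differences are bounded; they lie in a translate of a finite-dimensional space, whose
    bounded sequences subconverge in norm. *)
Lemma attained_finite_dim_affine A B : A !=set0 -> B !=set0 ->
  finite_dim_affine A -> finite_dim_affine B -> attained A B.
Proof.
move=> A0 B0 [At AAt /finite_dim_span[ws Atws]] [Bt BBt /finite_dim_span[vs Btvs]].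
have [w AB] := affine_mink_sub AAt BBt.
have [a [b [Aa Bb abd]]] := minimizing_seq A0 B0.
have cAB : bounded_subseq (mink_add At Bt).
  rewrite Btvs mink_add_span Atws.
  have -> : span_over (span_over [set 0] ws) vs
      = span_over [set (0 : X)] (vs ++ ws).
    by elim: (vs) => //= v us ->.
  exact: span_bounded_subseq.
have [||phi phiI [z ABz abz]] := cAB (fun k => a k - b k - w)
    (dist A B + 1 + rnorm w).
- move=> k; suff : mink_sub A B (a k - b k) by rewrite AB.
  by exists (a k) => //; exists (b k).
- move=> k; apply: le_trans (ler_rnormB _ _) _; rewrite lerD2r.
  exact: (minimizing_bound abd).
have wz : rweak_cvg_to \oo (fun k => a (phi k) - b (phi k)) (z + w).
  apply: cvg_rweak; have -> : (fun k => rnorm (a (phi k) - b (phi k) - (z + w)))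
      = fun k => rnorm (a (phi k) - b (phi k) - w - z).
    by apply/funext => k; rewrite opprD [- z - w]addrC addrA.
  exact: abz.
apply: (attained_weak phiI abd (cvg_dist_harmonic _) wz).
by rewrite AB /= addrK.
Qed.

Lemma attained_finite_dim A B : A !=set0 -> B !=set0 ->
  finite_dim [set: X] -> nclosed A -> nclosed B ->
  (forall d : R, exists M : R, forall x y, A x -> B y -> rnorm (x - y) <= d ->
    rnorm x <= M /\ rnorm y <= M) -> attained A B.
Proof.
move=> A0 B0 /finite_dim_span[ws XE] clA clB bAB.
have cX := @span_bounded_subseq _ _ X ws; rewrite -XE in cX.
have cl C u x : nclosed C -> (forall k, C (u k)) ->
    rnorm (u k - x) @[k --> \oo] --> (0 : R) -> C x.
  move=> clC Cu ux; apply: clC => e e0.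
  have /cvgrPdist_lt/(_ _ e0)[N _ NP] := ux.
  exists (u N) => //; have := NP N (leqnn N).
  by rewrite sub0r normrN ger0_norm ?rnorm_ge0// rnorm_distC.
have [a [b [Aa Bb abd]]] := minimizing_seq A0 B0.
have [M abM] := bAB (dist A B + 1).
have {}abM k := abM _ _ (Aa k) (Bb k) (minimizing_bound abd k).
have [phi phiI [x _ ax]] := cX a M (fun=> I) (fun k => (abM k).1).
have [psi psiI [y _ bY]] := cX (b \o phi) M (fun=> I) (fun k => (abM (phi k)).2).
apply: (attained_weak (subseq_comp phiI psiI) abd (cvg_dist_harmonic _)).
  exact: rweakB (rweak_subseq psiI (cvg_rweak ax)) (cvg_rweak bY).
exists x; first by apply: cl clA _ ax => k; exact: Aa.
by exists y => //; apply: cl clB _ bY => k; exact: Bb.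
Qed.

(** An instance of [attained_mink_add]: the shifted bases are the compact parts, and the difference
    of the two axes is a translate of a finite real span, hence weakly closed. *)
Lemma attained_gen_hypercylinder A B C D : bounded_weak_subseq X ->
  A !=set0 -> B !=set0 -> gen_hypercylinder A C -> gen_hypercylinder B D ->
  rweak_compact C -> rweak_compact D -> attained A B.
Proof.
move=> bws A0 B0 [L [c [[u [v [_ LE]]] _ AE]]] [L' [d [[u' [v' [_ LE']]] _ BE]]] cC cD.
have shift_compact (E : set X) e : rweak_compact E -> rweak_compact (mink_sub E [set e]).
  move=> cE w wE; have [|phi phiI [x Ex wx]] := cE (fun k => w k + e).
    by move=> k; have [y Ey [_ -> <-]] := wE k; rewrite subrK.
  exists phi => //; exists (x - e); first by exists x => //; exists e.
  have -> : w \o phi = fun k => (w (phi k) + e) - e by apply/funext => k; rewrite addrK.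
  by apply: rweakB; [exact: wx|exact: rweak_cst].
rewrite AE BE in A0 B0 *; rewrite mink_addC in A0 *.
rewrite [mink_add L' _]mink_addC in B0 *.
apply: attained_mink_add => //; [exact: shift_compact|exact: shift_compact|].
have -> : mink_sub L L' = [set x | span_over [set 0] [:: v; v'] (x - (u - u'))].
  rewrite LE LE'; apply/seteqP; split.
    move=> _ [_ [t _ <-] [_ [t' _ <-] <-]] /=; exists ((- t') *r v').
      by exists 0 => //; exists (- t'); rewrite add0r.
    exists t; rewrite opprD addrACA. by rewrite [LHS]addrC addKr rscaleNl addrC.
  move=> x /= [_ [_ -> [t' ->]] [t xE]]; exists (u + t *r v); first by exists t.
  exists (u' + (- t') *r v'); first by exists (- t').
  rewrite opprD rscaleNl opprK addrACA -[RHS](subrK (u - u')) xE add0r.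
  by rewrite [RHS]addrC [t *r v + _]addrC.
have ss := span_over_rsubspace [:: v; v'] (@rsubspace0 _ _ X).
apply: convex_weakly_seq_closed; last exact: rconvex_shift (rsubspace_convex ss).
apply: nclosed_shift; exact: span_over_closed (@rsubspace0 _ _ X) (@nclosed0 _ _ X).
Qed.

End Affine.

(** * Complemented subspaces, weak-star compactness, Voronoi cells *)

Section ComplementedSubspaces.
Context {R : realType} {s : scalar_kind}.
Local Notation K := (scalar_field R s).
Context {X : normedModType K}.
Implicit Types (u : nat -> X) (x y z : X) (A B C L F : set X).

Lemma rweak_unique u x y : rweak_cvg_to \oo u x -> rweak_cvg_to \oo u y -> x = y.
Proof.
move=> ux uy; have xy : rweak_cvg_to \oo (fun k => u k - u k) (x - y).
  exact: rweakB.
apply/eqP; rewrite -subr_eq0; apply/eqP/rnorm0_eq0/eqP.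
rewrite eq_le rnorm_ge0 andbT.
apply: (rweak_norm_le xy _ (cvg_cst (0 : R))) => k.
by rewrite subrr rnorm0.
Qed.

(** Baire's argument: otherwise nested balls could be chosen so that the one chosen at stage [n]
    avoids [S n], and their common point would lie in no [S n]. *)
Lemma closed_cover_interior (S : nat -> set X) : banach X ->
  (forall n, nclosed (S n)) -> (forall x, exists n0, forall n, (n0 <= n)%N -> S n x) ->
  exists n x, exists2 r, 0 < r & forall y, rnorm (x - y) <= r -> S n y.
Proof.
move=> bX clS ST; apply: contrapT => noint.
pose St := {xr : X * R | 0 < xr.2}.
have /choice[next nextP] : forall nxr : nat * St, exists yt : St,
    [/\ (sval yt).2 <= nxr.1.+1%:R^-1,
        forall z, rnorm ((sval yt).1 - z) <= (sval yt).2 ->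
          rnorm ((sval nxr.2).1 - z) <= (sval nxr.2).2
      & forall z, rnorm ((sval yt).1 - z) <= (sval yt).2 -> ~ S nxr.1 z].
  move=> [n [[x r] /= r0]].
  have [y xy nSy] : exists2 y, rnorm (x - y) <= r / 2 & ~ S n y.
    apply: contrapT => ny; apply: noint; exists n, x, (r / 2); first exact: half_gt0.
    by move=> y xy; apply: contrapT => nSy; apply: ny; exists y.
  have [d d0 dS] := nclosedPn (clS n) nSy.
  (* The three bounds keep the new ball away from [S n], keep it inside the old ball, and make the
     centres a Cauchy sequence. *)
  pose t := Num.min (d / 2) (Num.min (r / 2) n.+1%:R^-1).
  have t0 : 0 < t by rewrite !lt_min !half_gt0//= invr_gt0.
  have tn : t <= n.+1%:R^-1 by rewrite /t !ge_min lexx !orbT.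
  have tr : t <= r / 2 by rewrite /t !ge_min lexx orbT.
  have td : t <= d / 2 by rewrite /t !ge_min lexx.
  clearbody t; exists (exist _ (y, t) t0); split => //= z yz.
    have := rnorm_triangle y x z; lra.
  by move=> /dS; lra.
pose st := fix st k : St := if k is k'.+1 then next (k', st k')
  else exist _ (0 : X, 1) ltr01.
pose x k := (sval (st k)).1; pose r k := (sval (st k)).2.
have nested i j z : (i <= j)%N -> rnorm (x j - z) <= r j -> rnorm (x i - z) <= r i.
  move=> ij; rewrite -(subnKC ij); elim: (j - i)%N z => [|k IH] z; rewrite ?addn0//.
  rewrite addnS => xz; apply: IH.
  by case: (nextP ((i + k)%N, st (i + k)%N)) => _ + _; apply.
have r_gt0 k : 0 < r k by exact: svalP (st k).
have x_near i j : (i <= j)%N -> rnorm (x i - x j) <= r i.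
  by move=> ij; apply: (nested _ _ _ ij); rewrite subrr rnorm0 ltW.
have r_le k : r k.+1 <= k.+1%:R^-1 by case: (nextP (k, st k)).
have [e e0|y xy] := banach_cvg (u := x) bX.
  have /cvgrPdist_lt/(_ _ (half_gt0 e0))[N _ NP] := @cvg_harmonic R.
  exists N.+1 => i j Ni Nj; have := rnorm_triangle (x N.+1) (x i) (x j).
  rewrite (rnorm_distC (x i) (x N.+1)).
  have := x_near _ _ Ni; have := x_near _ _ Nj.
  have := r_le N; have := NP N (leqnn N).
  rewrite sub0r normrN ger0_norm ?harmonic_ge0//=.
  move: N.+1%:R^-1 => ?; lra.
have xy_le k : rnorm (x k - y) <= r k.
  apply/ler_addgt0Pr => e e0; have /cvgrPdist_lt/(_ _ e0)[N _ NP] := xy.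
  have := NP (maxn k N) (leq_maxr k N).
  rewrite sub0r normrN ger0_norm ?rnorm_ge0// => xye.
  have := rnorm_triangle (x (maxn k N)) (x k) y.
  have := x_near _ _ (leq_maxl k N); lra.
have [n Sny] := ST y; case: (nextP (n, st n)) => _ _ /(_ y (xy_le n.+1)); apply.
exact: Sny.
Qed.

Section Complement.
Variables A F : set X.
Hypothesis bX : banach X.
Hypothesis bws : bounded_weak_subseq X.
Hypothesis AF : complemented A F.

Let sA : rsubspace A. Proof. by case: AF => -[/linear_rsubspace]. Qed.
Let sF : rsubspace F. Proof. by case: AF => _ [/linear_rsubspace]. Qed.
Let clA : nclosed A. Proof. by case: AF => -[_ /closed_nclosed]. Qed.
Let clF : nclosed F. Proof. by case: AF => _ [_ /closed_nclosed]. Qed.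
Let AF0 x : A x -> F x -> x = 0.
Proof.
by case: AF => _ _ AF0 _ Ax Fx; have : (A `&` F) x by []; rewrite AF0.
Qed.

Let decomp_unique a f a' f' : A a -> F f -> A a' -> F f' ->
  a + f = a' + f' -> a = a' /\ f = f'.
Proof.
move=> Aa Ff Aa' Ff' eqs; have eqd : a - a' = f' - f.
  by apply/eqP; rewrite subr_eq addrAC eq_sym subr_eq eq_sym eqs addrC.
have a0 : a - a' = 0.
  by apply: AF0; [exact: rsubspaceB|rewrite eqd; exact: rsubspaceB].
split; apply/eqP; first by rewrite -subr_eq0 a0.
by rewrite eq_sym -subr_eq0 -eqd a0.
Qed.

(* By weak compactness the sets of all [a + f] with [a] and [f] in balls of radius
   [n] are closed; one of them has an interior point by Baire's theorem. *)
Lemma complement_bound : exists2 c, 0 < c &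
  forall a f, A a -> F f -> rnorm f <= c * rnorm (a + f).
Proof.
pose S (n : nat) := [set x | exists a f, [/\ A a, F f, x = a + f,
  rnorm a <= n%:R & rnorm f <= n%:R]].
have clS n : nclosed (S n).
  move=> x xS; have /choice[p pP] : forall k : nat, exists p : X * X,
      [/\ A p.1, F p.2, rnorm p.1 <= n%:R, rnorm p.2 <= n%:R &
        rnorm (x - (p.1 + p.2)) < k.+1%:R^-1].
    move=> k; have k0 : 0 < k.+1%:R^-1 :> R by rewrite invr_gt0.
    by have [_ [a [f [Aa Ff -> an fn]]] xaf] := xS _ k0; exists (a, f).
  have [|phi phiI [a pa]] := bws (u := fst \o p) (M := n%:R).
    by move=> k; case: (pP k).
  have [|psi psiI [f pf]] := bws (u := snd \o p \o phi) (M := n%:R).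
    by move=> k; case: (pP (phi k)).
  have {}pa := rweak_subseq psiI pa.
  have Aa : A a.
    apply: (rweak_closed clA (rsubspace_convex sA) _ pa) => k /=.
    by case: (pP (phi (psi k))).
  have Ff : F f.
    apply: (rweak_closed clF (rsubspace_convex sF) _ pf) => k /=.
    by case: (pP (phi (psi k))).
  have phipsiI := subseq_comp phiI psiI.
  exists a, f; split => //.
  - apply: (rweak_unique (u := fun k => (p (phi (psi k))).1 + (p (phi (psi k))).2)).
      apply: (@rweak_subseq _ _ _ (fun k => (p k).1 + (p k).2) x _ phipsiI).
      apply: cvg_rweak; apply: (cvg0_le _ (@cvg_harmonic R)) => k.
      by rewrite rnorm_ge0 rnorm_distC ltW//; case: (pP k).
    exact: (rweakD pa pf).
  - apply: (rweak_norm_le pa _ (cvg_cst (n%:R : R))) => k /=.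
    by case: (pP (phi (psi k))).
  - apply: (rweak_norm_le pf _ (cvg_cst (n%:R : R))) => k /=.
    by case: (pP (phi (psi k))).
have [x|n [x [r r0 xS]]] := closed_cover_interior bX clS.
  have [a Aa [f Ff xE]] : mink_add A F x by case: AF => _ _ _ ->.
  exists (Num.truncn (rnorm a + rnorm f)).+1 => n nN.
  have afn : rnorm a + rnorm f <= n%:R.
    by rewrite (le_trans (ltW (Num.Theory.truncnS_gt _)))// ler_nat.
  exists a, f; split => //; apply: le_trans afn.
    by rewrite lerDl rnorm_ge0.
  by rewrite lerDr rnorm_ge0.
have n0 : 0 <= n%:R :> R by [].
(* Both [x] and [x + t *r z], at distance [r], lie in [S n], so the [F]-part of [t *r z] has norm at
   most [2 * n%:R]; the 1 keeps the constant positive for [n = 0]. *)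
exists ((2 * n%:R + 1) / r); first by rewrite divr_gt0// ltr_wpDl ?mulr_ge0.
move=> a f Aa Ff; set z := a + f.
have [z0|z0] := eqVneq z 0.
  have [_ ->] := decomp_unique Aa Ff sA.1 sF.1 (etrans z0 (esym (addr0 0))).
  by rewrite z0 !rnorm0 mulr0.
have rz : 0 < rnorm z.
  rewrite lt_neqAle rnorm_ge0 andbT eq_sym; apply: contra_neq z0.
  exact: rnorm0_eq0.
pose t := r / rnorm z; have t0 : 0 < t by rewrite divr_gt0.
have [|a1 [f1 [Aa1 Ff1 xE an fn]]] := xS x; first by rewrite subrr rnorm0 ltW.
have [|a2 [f2 [Aa2 Ff2 xzE an2 fn2]]] := xS (x + t *r z).
  by rewrite opprD addrA subrr sub0r rnormN rnorm_rscale gtr0_norm// divfK ?gt_eqF.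
have [_ tf] : t *r a = a2 - a1 /\ t *r f = f2 - f1.
  apply: decomp_unique; [exact: rsubspaceZ|exact: rsubspaceZ|exact: rsubspaceB
    |exact: rsubspaceB|].
  by rewrite -rscaleDr -/z addrACA -opprD -xzE -xE addrAC subrr add0r.
have : rnorm (t *r f) <= 2 * n%:R.
  by rewrite tf (le_trans (ler_rnormB _ _))//; lra.
rewrite rnorm_rscale gtr0_norm// mulrAC ler_pdivrMr// => h.
by rewrite mulrAC ler_pdivlMr// mulrC (le_trans h)// ler_wpM2r ?rnorm_ge0// lerDl.
Qed.

(** The [F]-part of a limit of points of [A + B] is a limit of projections of points of [B], by
    boundedness of the projection. So it is the projection of some [b], and [z - b] falls in [A]. *)
Lemma proj_along_closed_sum B : rsubspace B ->
  nclosed (proj_along A F @` B) -> nclosed (mink_add A B).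
Proof.
move=> sB clP; have [c c0 cP] := complement_bound.
have decomp x : exists a f, [/\ A a, F f, x = a + f & proj_along A F x = f].
  have [a Aa [f Ff xE]] : mink_add A F x by case: AF => _ _ _ ->.
  exists a, f; split => //; have /(xgetPex 0) [Ff' [a' Aa' xE']] :
    exists z2, [set z2 | F z2 /\ exists2 z1, A z1 & x = z1 + z2] z2.
    by exists f; split => //; exists a.
  by have [_ e] := decomp_unique Aa' Ff' Aa Ff (etrans (esym xE') (esym xE)); exact: e.
move=> z zAB; have [az [fz [Aaz Ffz zE _]]] := decomp z.
have [|b Bb bfz] := clP fz.
  move=> e e0; have [x [a Aa [b Bb abx]] zx] := zAB _ (divr_gt0 e0 c0).
  have [ab [fb [Aab Ffb bE pb]]] := decomp b.
  exists fb; first by exists b.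
  have zxE : z - x = (az - (a + ab)) + (fz - fb).
    by rewrite zE -abx bE addrA opprD addrACA.
  rewrite (le_lt_trans (cP (az - (a + ab)) (fz - fb) _ _))//.
  - by apply: rsubspaceB => //; exact: rsubspaceD.
  - exact: rsubspaceB.
  - by rewrite -zxE mulrC -ltr_pdivlMr.
have [ab [fb [Aab Ffb bE pb]]] := decomp b.
exists (az - ab); first exact: rsubspaceB.
by exists b => //; rewrite bE zE -bfz pb addrA subrK.
Qed.

End Complement.
End ComplementedSubspaces.

(** * Weak-star convergence in the dual of a separable space *)

Section WeakStar.
Context {R : realType} {s : scalar_kind}.
Local Notation K := (scalar_field R s).
Context {X Y : normedModType K}.
Implicit Types (u : nat -> X) (x : X) (y : Y) (A B : set X).

Variable J : {linear X -> dual_space Y}.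

Definition rweak_star_cvg u x :=
  forall y, sre (J (u k) y) @[k --> \oo] --> (sre (J x y) : R).

Lemma weak_star_cvgP u x : weak_star_cvg J u x <-> rweak_star_cvg u x.
Proof.
split => ux y; first exact: cvg_sre (ux y).
apply: cvg_sre_sI; first exact: ux.
have := ux (sI *: y); rewrite linearZ.
by under eq_fun do rewrite linearZ.
Qed.

Lemma rweak_star_norm_le u x (d : nat -> R) (l : R) :
  (forall x, `|J x| = `|x|) -> rweak_star_cvg u x ->
  (forall k, rnorm (u k) <= d k) -> d k @[k --> \oo] --> l -> rnorm x <= l.
Proof.
move=> Jn /weak_star_cvgP ux ud dl.
have JE z : rnorm z = dual_norm (J z) by rewrite -rnorm_dualE /rnorm Jn.
rewrite JE; apply: dual_norm_le => y y1.
have Jy : rnorm (J (u k) y) @[k --> \oo] --> rnorm (J x y).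
  have /cvg_rnormP := ux y; apply: cvg_dist_le => k; exact: ler_rnorm_dist.
apply: (cvg_ler Jy dl) => k; apply: le_trans (dual_norm_bound _ _) _.
by rewrite -JE (le_trans _ (ud k))// ler_piMr ?rnorm_ge0.
Qed.

(** Here the countable separating family of [ultra_subseq] is given by evaluation at a dense
    sequence of [Y]. *)
Lemma weak_star_bounded_subseq u (M : R) : separable Y -> bijective J ->
  (forall x, `|J x| = `|x|) -> (forall k, rnorm (u k) <= M) ->
  exists2 phi : nat -> nat, {homo phi : i j / (i < j)%N} &
    exists x, rweak_star_cvg (u \o phi) x.
Proof.
move=> [D cD dD] [J' J'K JK] Jn uM.
have JE z : rnorm z = dual_norm (J z) by rewrite -rnorm_dualE /rnorm Jn.
have [y0 Dy0] : D !=set0.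
  have [|y [_ Dy]] := dD setT _ openT; first by exists 0.
  by exists y.
have /pfcard_geP[D0|[enum]] := cD.
  by move: Dy0; rewrite D0.
have D_dense y e : 0 < e -> exists n, rnorm (y - enum n) < e.
  move=> e0; have := rnorm_nbhs y e0.
  rewrite nbhsE => -[V [Vo Vy] VP].
  have [|z [Vz Dz]] := dD V _ Vo; first by exists y.
  have [n _ nz] := @surj _ _ setT D enum z Dz.
  by exists n; rewrite nz; exact: VP.
have [|U ultraU|x z _ _ xz _ [y ->]|phi phiI [x _ ux]] := @ultra_subseq R X u
    [set g | exists y, g = fun x => sre (J x y)]
    (fun n x => sre (J x (enum n))) setT.
- by move=> n; exists (enum n).
- have [||h rh hU] := @ultra_functional R s Y U (fun k y => sre (J (u k) y)) M ultraU.
  + by move=> k; exact: dual_real_functional.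
  + move=> k y; apply: le_trans (ler_sre _) (le_trans (dual_norm_bound _ _) _).
    by rewrite -JE ler_wpM2r ?rnorm_ge0.
  have [f fh] := real_functional_dual rh.
  by exists (J' f) => // _ [y ->]; rewrite JK fh; exact: hU.
- apply/eqP; rewrite -subr_eq0 -sreB; apply/eqP.
  have -> : J x y - J z y = J (x - z) y by rewrite linearB.
  apply/eqP; rewrite -normr_eq0 eq_le normr_ge0 andbT.
  apply/ler_addgt0Pr => e e0; rewrite add0r.
  have d0 : 0 < dual_norm (J (x - z)) + 1 by rewrite ltr_wpDl ?dual_norm_ge0.
  have [n yn] := D_dense y _ (divr_gt0 e0 d0).
  have -> : sre (J (x - z) y) = sre (J (x - z) (y - enum n)).
    have eq0 : sre (J (x - z) (enum n)) = 0.
      have -> : J (x - z) (enum n) = J x (enum n) - J z (enum n) by rewrite linearB.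
      by rewrite sreB xz subrr.
    by rewrite (linearB (J (x - z)) y) sreB eq0 subr0.
  apply: le_trans (ler_sre _) (le_trans (dual_norm_bound _ _) _).
  move: yn; rewrite ltr_pdivlMr// mulrC => /ltW; apply: le_trans.
  by rewrite ler_wpM2r ?rnorm_ge0// lerDl.
- by exists phi => //; exists x => y; exact: (ux _ (ex_intro _ y erefl)).
Qed.

Lemma attained_weak_star A B : A !=set0 -> B !=set0 ->
  separable Y -> dual_identification J ->
  weak_star_seq_compact J A -> weak_star_seq_closed J B -> attained A B.
Proof.
move=> A0 B0 sY [bJ Jn] cA clB; have [a [b [Aa Bb abd]]] := minimizing_seq A0 B0.
have [phi [phiI [x Ax /weak_star_cvgP ax]]] := cA a Aa.
have [|psi psiI [w ww]] := @weak_star_bounded_subseq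
    (fun k => a (phi k) - b (phi k)) (dist A B + 1) sY bJ Jn.
  by move=> k; exact: (minimizing_bound abd).
have phipsiI := subseq_comp phiI psiI.
have ax' : rweak_star_cvg (a \o (phi \o psi)) x.
  by move=> y; exact: cvg_subseq psiI (ax y).
have Bxw : B (x - w).
  apply: (clB (b \o (phi \o psi))) => [k|]; first exact: Bb.
  apply/weak_star_cvgP => y; rewrite linearB/= sreB.
  have -> : (fun k => sre (J ((b \o (phi \o psi)) k) y)) =
      fun k => sre (J (a (phi (psi k))) y) -
               sre (J (a (phi (psi k)) - b (phi (psi k))) y).
    by apply/funext => k /=; rewrite linearB/= sreB subKr.
  by apply: cvgB; [exact: ax'|exact: ww].
apply: (attained_le Ax Bxw); rewrite subKr.
apply: (rweak_star_norm_le Jn ww _ (cvg_subseq phipsiI (cvg_dist_harmonic _))) => k.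
exact: abd.
Qed.

End WeakStar.

(** * Voronoi cells *)

Section VoronoiCells.
Context {R : realType} {s : scalar_kind}.
Local Notation K := (scalar_field R s).
Context {X : normedModType K}.
Implicit Types (x y z p : X) (A B P : set X).

(** A point of the cell that is within [d] of [A] is within [d + 1] of the bounded set [P]; the 1 is
    there because the distance to [P] may not be attained. *)
Lemma voronoi_bound A P (d M : R) x y : P !=set0 ->
  (forall p, P p -> rnorm p <= M) -> A x -> pdist y P <= pdist y A ->
  rnorm (x - y) <= d -> rnorm x <= d + (d + 1 + M) /\ rnorm y <= d + (d + 1 + M).
Proof.
move=> P0 PM Ax yPA xy; have d0 : 0 <= d := le_trans (rnorm_ge0 _) xy.
have [p Pp yp] : exists2 p, P p & rnorm (y - p) < d + 1.
  apply: pdist_ltP => //; apply: le_lt_trans yPA _.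
  by rewrite (le_lt_trans (pdist_le _ Ax))// rnorm_distC (le_lt_trans xy)// ltrDl.
have yM : rnorm y <= d + 1 + M.
  by rewrite -[y](subrK p) (le_trans (ler_rnormD _ _))// lerD ?PM// ltW.
split; last by rewrite (le_trans yM)// lerDr.
by rewrite -[x](subrK y) (le_trans (ler_rnormD _ _))// lerD.
Qed.

Lemma voronoi_nclosed A P : A !=set0 -> P !=set0 -> nclosed (voronoi_cell P A).
Proof.
move=> A0 P0 z zV; rewrite /voronoi_cell /=; apply/ler_addgt0Pr => e e0.
have [c cV zc] := zV _ (half_gt0 e0); have {}cV : pdist c P <= pdist c A := cV.
have := pdist_lipschitz z c P0; have := pdist_lipschitz c z A0.
rewrite (rnorm_distC c z); lra.
Qed.

Lemma pdist_set1 z p : pdist z [set p] = rnorm (z - p).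
Proof.
apply/eqP; rewrite eq_le pdist_le//= pdist_ge//; first by exists p.
by move=> _ ->.
Qed.

(* In a Hilbert space the cell of [p] is an intersection of half-spaces. *)
Lemma voronoi_weakly_seq_closed A p : hilbert X -> A !=set0 ->
  weakly_seq_closed [set z | rnorm (z - p) <= pdist z A].
Proof.
move=> /hilbert_real_dot[_ [dot rdot]] A0 u x uV /weak_cvgP ux /=.
have halfspace z a : (rnorm (z - p) <= rnorm (z - a)) =
    (2 * dot (a - p) z <= rnorm a ^+ 2 - rnorm p ^+ 2).
  rewrite -ler_sqr ?nnegrE ?rnorm_ge0// !(dotE rdot) !(dot_simp rdot).
  rewrite (dotC rdot z p) (dotC rdot z a).
  by apply/idP/idP; lra.
apply: pdist_ge => // a Aa; rewrite halfspace.
have lim : 2 * dot (a - p) (u k) @[k --> \oo] --> 2 * dot (a - p) x.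
  by apply: cvgMr; exact: (ux _ (dot_functional rdot (a - p))).
apply: (cvg_ler lim (cvg_cst (rnorm a ^+ 2 - rnorm p ^+ 2))) => k.
by rewrite -halfspace (le_trans (uV k))// pdist_le.
Qed.

Lemma attained_voronoi_hilbert A p : hilbert X -> A !=set0 ->
  [set z | rnorm (z - p) <= pdist z A] !=set0 -> weakly_seq_closed A ->
  attained A [set z | rnorm (z - p) <= pdist z A].
Proof.
move=> hX A0 B0 clA.
have bws := ultra_reflexive_bounded_weak_subseq (hilbert_ultra_reflexive hX).
apply: attained_bounded_pairs => //; first exact: voronoi_weakly_seq_closed.
move=> d; exists (d + (d + 1 + rnorm p)) => x y Ax yB xy.
apply: (@voronoi_bound A [set p]) => //; first by exists p.
  by move=> _ ->.
by rewrite pdist_set1.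
Qed.

Lemma attained_voronoi_finite_dim A P : finite_dim [set: X] -> closed A ->
  A !=set0 -> P !=set0 -> bounded_set P -> voronoi_cell P A !=set0 ->
  attained A (voronoi_cell P A).
Proof.
move=> fX clA A0 P0 /bounded_set_rnorm[M PM] B0.
apply: attained_finite_dim => //; first exact: closed_nclosed.
  exact: voronoi_nclosed.
move=> d; exists (d + (d + 1 + M)) => x y Ax yB; exact: (voronoi_bound P0 PM Ax yB).
Qed.

End VoronoiCells.

(** * Polyhedral sets *)

Section FourierMotzkin.
Context {R : realType} {s : scalar_kind}.
Local Notation K := (scalar_field R s).
Context {X : normedModType K}.
Implicit Types (x y z w : X) (A B : set X) (f g : X -> R).

(** Positive [a i] bound [t] from above, negative ones from below, and each lower bound must not
    exceed each upper one. The conditions are cleared of denominators to stay linear in [r]. *)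
Lemma linear_inequalities_solvable (I : finType) (a r : I -> R) :
  (exists t, forall i, a i * t <= r i) <->
  (forall i j, [/\ a i = 0 -> 0 <= r i &
     0 < a i -> a j < 0 -> 0 <= a i * r j - a j * r i]).
Proof.
split => [[t tP] i j|H].
  split => [ai|ai aj]; first by have := tP i; rewrite ai mul0r.
  have := ler_wpM2l (ltW ai) (tP j); have := ler_wnM2l (ltW aj) (tP i); lra.
have solve t : (forall i, 0 < a i -> t <= r i / a i) ->
    (forall i, a i < 0 -> r i / a i <= t) -> exists t, forall i, a i * t <= r i.
  move=> tpos tneg; exists t => i; have [ai|ai|ai] := ltgtP (a i) 0.
  - by have := tneg i ai; rewrite ler_ndivrMr// mulrC.
  - by have := tpos i ai; rewrite ler_pdivlMr// mulrC.
  - by rewrite ai mul0r; have [/(_ ai)] := H i i.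
have compare i j : 0 < a i -> a j < 0 -> r j / a j <= r i / a i.
  move=> ai aj; rewrite ler_ndivrMr// mulrAC ler_pdivrMr//.
  by have [_ /(_ ai aj)] := H i j; lra.
(* The largest lower bound serves as [t], else the smallest upper bound, else 0. *)
have [[j0 aj0]|noneg] := pselect (exists j, a j < 0).
  have [j aj jmax] := @arg_maxP _ _ I j0 (fun j => a j < 0)
    (fun j => r j / a j) aj0.
  by apply: (solve (r j / a j)) => [i ai|i ai]; [exact: compare|exact: jmax].
have [[i0 ai0]|nopos] := pselect (exists i, 0 < a i).
  have [i ai imin] := @arg_minP _ _ I i0 (fun i => 0 < a i)
    (fun i => r i / a i) ai0.
  apply: (solve (r i / a i)) => [k ak|k ak]; first exact: imin.
  by case: noneg; exists k.
apply: (solve 0) => i ai; first by case: nopos; exists i.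
by case: noneg; exists i.
Qed.

Lemma real_functional0 : real_functional (fun _ : X => 0 : R).
Proof.
split => [x y|t x|]; rewrite ?addr0 ?mulr0//.
by exists 0 => x; rewrite normr0 mul0r.
Qed.

Lemma real_functional_comb (a b : R) f g : real_functional f -> real_functional g ->
  real_functional (fun x => a * f x + b * g x).
Proof.
move=> rf rg; split => [x y|t x|].
- by rewrite (rfunD rf) (rfunD rg); ring.
- by rewrite (rfunZ rf) (rfunZ rg); ring.
have [M M0 fM] := rfun_bound rf; have [N N0 gN] := rfun_bound rg.
exists (`|a| * M + `|b| * N) => x; rewrite (le_trans (ler_normD _ _))//.
by rewrite mulrDl !normrM -!mulrA lerD// ler_wpM2l.
Qed.

(* The existential [y] is eliminated one direction of [ws] at a time. *)
Lemma projection_nclosed (ws : seq X) (I : finType) (f g : I -> X -> R) (b : I -> R) :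
  (forall i, real_functional (f i)) -> (forall i, real_functional (g i)) ->
  nclosed [set z | exists2 y, span_over [set 0] ws y &
    forall i, f i z + g i y <= b i].
Proof.
elim: ws I f g b => [|w ws IH] I f g b rf rg.
  move=> z zP; exists 0 => // i; rewrite (rfun0 (rg i)) addr0.
  have [M M0 fM] := rfun_bound (rf i); apply/ler_addgt0Pr => e e0.
  have [c [_ -> /(_ i)]] := zP _ (divr_gt0 e0 M0).
  rewrite (rfun0 (rg i)) addr0 ltr_pdivlMr// => ci zc.
  have := le_trans (ler_norm _) (fM (z - c)); rewrite (rfunB (rf i)) mulrC; lra.
pose a i := g i w.
(* The inequality left by the pair [(i, j)] once the coefficient of [w] is eliminated; pairs that
   contribute nothing get the trivial one with all terms 0. *)
pose sel (i j : I) (u v : R) : R :=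
  if a i == 0 then u else if (0 < a i) && (a j < 0) then a i * v - a j * u else 0.
have rsel i j (h : I -> X -> R) : (forall i, real_functional (h i)) ->
    real_functional (fun x => sel i j (h i x) (h j x)).
  move=> rh; rewrite /sel; case: (a i == 0) => //; case: (_ && _); last exact: real_functional0.
  have -> : (fun x => a i * h j x - a j * h i x) =
      fun x => - a j * h i x + a i * h j x by apply/funext => x; ring.
  exact: real_functional_comb.
suff -> : [set z | exists2 y, span_over [set 0] (w :: ws) y &
      forall i, f i z + g i y <= b i] =
    [set z | exists2 y, span_over [set 0] ws y & forall ij : I * I,
      sel ij.1 ij.2 (f ij.1 z) (f ij.2 z) + sel ij.1 ij.2 (g ij.1 y) (g ij.2 y)
      <= sel ij.1 ij.2 (b ij.1) (b ij.2)].
  by apply: (IH (I * I)%type) => ij; exact: rsel.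
have selE z y i j : (sel i j (f i z) (f j z) + sel i j (g i y) (g j y)
      <= sel i j (b i) (b j)) <->
    [/\ a i = 0 -> 0 <= b i - f i z - g i y &
      0 < a i -> a j < 0 ->
      0 <= a i * (b j - f j z - g j y) - a j * (b i - f i z - g i y)].
  rewrite /sel; have [ai|ai] := eqVneq (a i) 0.
    by rewrite ai ltxx; split => [h|[/(_ erefl)]]; [split => // _|]; lra.
  case: ifP => [/andP[ai0 aj]|naij].
    split => [h|[_ /(_ ai0 aj)]]; last by lra.
    by split => [/eqP|_ _]; [rewrite (negbTE ai)|lra].
  split => [_|_]; last by rewrite addr0.
  split => [/eqP|ai0 aj]; first by rewrite (negbTE ai).
  by rewrite ai0 aj in naij.
apply/seteqP; split => z /= [y].
  move=> [y' ys [t yE]] yP; exists y' => // -[i j] /=; apply/selE.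
  apply: (iffLR (linear_inequalities_solvable a (fun i => b i - f i z - g i y')) _ i j).
  exists t => k; have := yP k; rewrite yE (rfunD (rg k)) (rfunZ (rg k)) /a; lra.
move=> ys yP.
have /(linear_inequalities_solvable a (fun i => b i - f i z - g i y))[t tP] :
    forall i j, [/\ a i = 0 -> 0 <= b i - f i z - g i y & 0 < a i -> a j < 0 ->
      0 <= a i * (b j - f j z - g j y) - a j * (b i - f i z - g i y)].
  by move=> i j; apply/selE; exact: (yP (i, j)).
exists (y + t *r w); first by exists y => //; exists t.
by move=> k; have := tP k; rewrite (rfunD (rg k)) (rfunZ (rg k)) /a; lra.
Qed.

(** Finitely many functionals see only a finite-dimensional part of the space. A new vector is
    needed only if [g i] is nonzero somewhere on the common kernel of the previous ones. *)
Lemma functionals_span (I : eqType) (g : I -> X -> R) (l : seq I) :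
  (forall i, real_functional (g i)) ->
  exists ws, forall y, exists2 y', span_over [set 0] ws y' &
    forall i, i \in l -> g i y = g i y'.
Proof.
move=> rg; elim: l => [|i l [ws wsP]].
  by exists [::] => y; exists 0.
have [[n [nl ni]]|none] := pselect (exists n, (forall j, j \in l -> g j n = 0) /\ g i n != 0).
  exists (n :: ws) => y; have [y' ys yP] := wsP y.
  pose t := (g i y - g i y') / g i n; exists (y' + t *r n).
    by exists y' => //; exists t.
  move=> j; rewrite inE (rfunD (rg j)) (rfunZ (rg j)) => /orP[/eqP ->|jl].
    by rewrite divfK// addrC subrK.
  by rewrite nl// mulr0 addr0 yP.
exists ws => y; have [y' ys yP] := wsP y; exists y' => // j.
rewrite inE => /orP[/eqP ->|]; last exact: yP.
apply/eqP; rewrite -subr_eq0 -(rfunB (rg i)); apply: contrapT => /negP h.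
apply: none; exists (y - y'); split => // k kl.
by rewrite (rfunB (rg k)) yP// subrr.
Qed.

Lemma polyhedral_rconvex A : polyhedral A -> rconvex A.
Proof.
move=> [m [f [b ->]]] x y t /andP[t0 t1] xA yA i _ /=.
have rf := dual_real_functional (f i).
rewrite (rfunD rf) !(rfunZ rf).
have t1' : 0 <= 1 - t by rewrite subr_ge0.
have := ler_wpM2l t0 (xA i I); have := ler_wpM2l t1' (yA i I) => /=; lra.
Qed.

(** [z] lies in [A - B] when some [y] has [z + y] in [A] and [y] in [B]: finitely many inequalities
    in [z] and [y], from which [y] is eliminated. *)
Lemma polyhedral_mink_sub_nclosed A B : polyhedral A -> polyhedral B ->
  nclosed (mink_sub A B).
Proof.
move=> [m [f [b ->]]] [n [g [c ->]]].
pose F (k : 'I_m + 'I_n) : X -> R :=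
  match k with inl i => fun x => sre (f i x) | inr _ => fun=> 0 end.
pose G (k : 'I_m + 'I_n) : X -> R :=
  match k with inl i => fun x => sre (f i x) | inr j => fun x => sre (g j x) end.
pose h (k : 'I_m + 'I_n) : R := match k with inl i => b i | inr j => c j end.
have rF k : real_functional (F k).
  by case: k => ?; [exact: dual_real_functional|exact: real_functional0].
have rG k : real_functional (G k).
  by case: k => ?; exact: dual_real_functional.
have [ws wsP] := functionals_span (enum {: 'I_m + 'I_n}) rG.
suff -> : mink_sub (\bigcap_i [set x | sre (f i x) <= b i])
    (\bigcap_i [set x | sre (g i x) <= c i]) =
    [set z | exists2 y, span_over [set 0] ws y & forall k, F k z + G k y <= h k].
  exact: projection_nclosed.
apply/seteqP; split => z.
  move=> [x xA [y yB <-]]; have [y' ys yP] := wsP y; exists y' => // k.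
  rewrite -yP ?mem_enum//; case: k => [i|j] /=; last by rewrite add0r; exact: yB.
  by rewrite -sreD -linearD subrK; exact: xA.
move=> [y _ yP]; exists (z + y); last by exists y; rewrite ?addrK// => j _;
  have := yP (inr j); rewrite /= add0r.
by move=> i _ /=; have := yP (inl i); rewrite /= linearD sreD.
Qed.

Lemma attained_polyhedral A B : hilbert X -> A !=set0 -> B !=set0 ->
  polyhedral A -> polyhedral B -> attained A B.
Proof.
move=> hX A0 B0 pA pB; apply: attained_convex_mink_sub => //.
- exact: ultra_reflexive_bounded_weak_subseq (hilbert_ultra_reflexive hX).
- exact: polyhedral_mink_sub_nclosed.
- by apply: mink_sub_convex; exact: polyhedral_rconvex.
Qed.

End FourierMotzkin.

(** * Minimal norm vectors and the case distinction *)

Section MinimalNorm.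
Context {R : realType} {s : scalar_kind}.
Local Notation K := (scalar_field R s).
Context {X : normedModType K}.
Implicit Types A B C : set X.

Lemma pdist0E C : pdist 0 C = inf [set rnorm v | v in C].
Proof.
rewrite /pdist /dist; congr inf; apply/seteqP; split => r.
  by move=> [_ -> [v Cv <-]]; exists v => //; rewrite sub0r rnormN.
by move=> [v Cv <-]; exists 0 => //; exists v => //; rewrite sub0r rnormN.
Qed.

Lemma dist_mink_sub A B : dist A B = inf [set rnorm v | v in mink_sub A B].
Proof.
congr inf; apply/seteqP; split => r.
  move=> [x Ax [y By <-]]; exists (x - y) => //.
  by exists x => //; exists y.
by move=> [_ [x Ax [y By <-]] <-]; exists x => //; exists y.
Qed.

Lemma proximinal0P C : proximinal C [set 0] <-> min_norm_attained C.
Proof.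
split => [/(_ 0 erefl)[v Cv v0]|[v Cv v0] _ ->]; exists v => //.
  by rewrite -pdist0E v0 sub0r rnormN.
by rewrite pdist0E -v0 sub0r rnormN.
Qed.

Lemma attained_min_norm A B : min_norm_attained (mink_sub A B) -> attained A B.
Proof.
move=> [_ [x Ax [y By <-]] xy]; apply: (attained_le Ax By).
by rewrite xy dist_mink_sub.
Qed.

Lemma ball_locally_compact_rweak C : ball_locally_compact C ->
  forall x, C x -> exists2 r, 0 < r & rweak_compact (cball x r `&` C).
Proof.
by move=> lC x /lC[r r0 cr]; exists r => //; exact: compact_rweak_compact.
Qed.

Lemma locally_weakly_seq_compact_rweak C : locally_weakly_seq_compact C ->
  forall x, C x -> exists2 r, 0 < r & rweak_compact (cball x r `&` C).
Proof.
by move=> lC x /lC[r r0 cr]; exists r => //; exact: weakly_seq_compactP.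
Qed.

Lemma distance_minimizing_bound A B (u : nat -> X * X) :
  distance_minimizing A B u -> exists M, forall k, rnorm ((u k).1 - (u k).2) <= M.
Proof.
move=> [_ ud].
have /cvg_seq_bounded [M [Mr MP]] : cvgn (fun k => rnorm ((u k).1 - (u k).2)).
  by apply/cvg_ex; exists (dist A B).
exists (M + 1) => k; apply: le_trans (ler_norm _) _.
by apply: (MP (M + 1)) => //; rewrite ltrDl.
Qed.

End MinimalNorm.

Theorem theorem5p1 (R : realType) (s : scalar_kind)
    (X : normedModType (scalar_field R s)) (X_neq0 : exists x : X, x != 0)
    (A B : set X) (A_neq0 : A !=set0) (B_neq0 : B !=set0) :
  (* the equivalence asserted inside (ii) *)
  (proximinal (mink_sub A B) [set 0] <-> min_norm_attained (mink_sub A B)) /\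
  ((* i *)
     A `&` B !=set0
   \/ (* ii *)
     proximinal (mink_sub A B) [set 0]
   \/ (* iii *)
     [/\ weakly_seq_compact A, closed B, convex B
       & locally_weakly_seq_compact B]
   \/ (* iv *)
     [/\ compact A, closed B, convex B & ball_locally_compact B]
   \/ (* v *)
     [/\ weakly_seq_compact A, convex B & proximinal B A]
   \/ (* vi *)
     compact A /\ proximinal B A
   \/ (* vii *)
     [/\ boundedly_compact A, bounded_set B & proximinal B A]
   \/ (* viii *)
     [/\ boundedly_compact A, boundedly_compact B
       & bounded_set A \/ bounded_set B]
   \/ (* ix *)
     weakly_seq_compact A /\ weakly_seq_compact B
   \/ (* x *)
     compact A /\ compact B
   \/ (* xi *)
     (forall r : R, 0 < r ->
        weakly_seq_compact ([set z | pair_norm z <= r] `&` (A `*` B))) /\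
     (bounded_set (A `|` B) \/
      (~ bounded_set (A `|` B) /\ coercive_diff A B))
   \/ (* xii *)
     [/\ reflexive_banach X, weakly_seq_closed A, weakly_seq_closed B
       & exists2 u : nat -> X * X, distance_minimizing A B u &
         exists phi : nat -> nat, {homo phi : i j / (i < j)%N} /\
           bounded_set (range (fun k => (u (phi k)).1))]
   \/ (* xiii *)
     [/\ reflexive_banach X,
         weakly_seq_compact A \/ (bounded_set A /\ weakly_seq_closed A)
       & weakly_seq_closed B]
   \/ (* xiv *)
     [/\ reflexive_banach X, bounded_set A /\ weakly_closed A
       & closed B /\ convex B]
   \/ (* xv *)
     [/\ reflexive_banach X, closed A /\ convex A, closed B /\ convex B
       & bounded_set A]
   \/ (* xvi *)
     [/\ reflexive_banach X, weakly_seq_closed A /\ weakly_seq_closed B,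
         ~ bounded_set (A `|` B) & coercive_diff A B]
   \/ (* xvii *)
     [/\ reflexive_banach X, [/\ closed A, convex A, closed B & convex B],
         ~ bounded_set (A `|` B) & coercive_diff A B]
   \/ (* xviii *)
     reflexive_banach X /\ weakly_seq_closed (mink_sub A B)
   \/ (* xix *)
     [/\ reflexive_banach X, convex A, convex B & closed (mink_sub A B)]
   \/ (* xx *)
     reflexive_banach X /\
     (exists At Ah Bt Bh : set X,
        [/\ A = mink_add At Ah, B = mink_add Bt Bh,
            weakly_seq_compact At /\ weakly_seq_compact Bt
          & weakly_seq_closed (mink_sub Ah Bh)])
   \/ (* xxi *)
     [/\ reflexive_banach X, closed A
       & exists At F Bt : set X,
           [/\ has_linear_part A At, complemented At F,
               has_linear_part B Bt & closed (proj_along At F @` Bt)]]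
   \/ (* xxii *)
     [/\ reflexive_banach X, closed A, affine_subspace A
       & finite_dim_affine B]
   \/ (* xxiii *)
     [/\ reflexive_banach X, closed A, finite_codim_affine A
       & affine_subspace B]
   \/ (* xxiv *)
     (exists (Y : completeNormedModType (scalar_field R s))
             (J : {linear X -> dual_space Y}),
        [/\ separable Y, dual_identification J,
            weak_star_seq_compact J A & weak_star_seq_closed J B])
   \/ (* xxv *)
     [/\ s = RealScalars, hilbert X, polyhedral A & polyhedral B]
   \/ (* xxvi *)
     [/\ hilbert X, weakly_seq_closed A
       & exists2 p : X, ~ A p & B = [set z | rnorm (z - p) <= pdist z A]]
   \/ (* xxvii *)
     [/\ hilbert X, closed_hyperplane A
       & exists2 p : X, ~ A p & B = [set z | pdist z [set p] <= pdist z A]]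
   \/ (* xxviii *)
     reflexive_banach X /\
     (exists C D : set X,
        [/\ gen_hypercylinder A C, gen_hypercylinder B D,
            weakly_seq_compact C & weakly_seq_compact D])
   \/ (* xxix *)
     finite_dim_affine A /\ finite_dim_affine B
   \/ (* xxx *)
     [/\ finite_dim [set: X], closed A, closed B
       & bounded_set (A `|` B) \/
         (~ bounded_set (A `|` B) /\ coercive_diff A B)]
   \/ (* xxxi *)
     [/\ finite_dim [set: X], closed A
       & exists P : set X,
           [/\ P !=set0, bounded_set P & B = voronoi_cell P A]]
   \/ (* xxxii *)
     [/\ s = RealScalars, finite_dim [set: X], hilbert X
       & polyhedral A /\ polyhedral B]
   -> exists z : X * X, best_approx_pair A B z).
Proof.
split; first exact: proximinal0P.
rewrite -/(attained A B).
have bws : reflexive_banach X -> bounded_weak_subseq X.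
  by move=> rX; exact: ultra_reflexive_bounded_weak_subseq (reflexive_ultra_reflexive rX).
have closed_convex C : closed C -> convex C -> weakly_seq_closed C.
  by move=> /closed_nclosed clC /convex_rconvex; exact: convex_weakly_seq_closed.
case=> [[x [Ax Bx]]|].
  by apply: (attained_le Ax Bx); rewrite subrr rnorm0 dist_ge0.
case=> [/proximinal0P|]; first exact: attained_min_norm.
case=> [[/weakly_seq_compactP cA /closed_nclosed clB /convex_rconvex cB lB]|].
  apply: attained_rweak_compact_proximinal => //.
  exact: locally_rweak_compact_proximinal (locally_weakly_seq_compact_rweak lB).
case=> [[/compact_rweak_compact cA /closed_nclosed clB /convex_rconvex cB lB]|].
  apply: attained_rweak_compact_proximinal => //.
  exact: locally_rweak_compact_proximinal (ball_locally_compact_rweak lB).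
case=> [[/weakly_seq_compactP cA /convex_rconvex cB pB]|].
  exact: attained_rweak_compact_proximinal.
case=> [[cA pB]|]; first exact: attained_compact_proximinal.
case=> [[cA bB pB]|]; first exact: attained_boundedly_compact_proximinal.
case=> [[cA cB bAB]|]; first exact: attained_boundedly_compact.
case=> [[/weakly_seq_compactP cA /weakly_seq_compactP cB]|].
  exact: attained_rweak_compact.
case=> [[/compact_rweak_compact cA /compact_rweak_compact cB]|].
  exact: attained_rweak_compact.
case=> [[cAB bAB]|].
  by apply: attained_product => // d; exact: bounded_or_coercive_bound.
case=> [[/bws bX clA clB [u minu [phi [phiI bphi]]]]|].
  have [M uM] := distance_minimizing_bound minu.
  have [N uN] := bounded_set_rnorm bphi; have [uAB ud] := minu.
  (* The given sequence has no known rate, so its own distances serve as [d]. *)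
  apply: (@attained_bounded_subseq _ _ _ bX A B (fst \o u) (snd \o u)
    (fun k => rnorm ((u k).1 - (u k).2)) phi (Num.max M N)) => // k.
  - by case: (uAB k).
  - by case: (uAB k).
  - by rewrite le_max uN ?orbT//; exists k.
  - by rewrite le_max uM.
case=> [[/bws bX cA clB]|].
  case: cA => [/weakly_seq_compactP cA|[bA clA]].
    exact: attained_rweak_compact_closed.
  exact: attained_bounded.
case=> [[/bws bX [bA /weakly_closed_seq clA] [clB cB]]|].
  by apply: attained_bounded => //; exact: closed_convex.
case=> [[/bws bX [clA cA] [clB cB] bA]|].
  by apply: attained_bounded => //; exact: closed_convex.
case=> [[/bws bX [clA clB] _ coer]|].
  by apply: attained_bounded_pairs => // d; exact: coercive_bound.
case=> [[/bws bX [clA cA clB cB] _ coer]|].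
  apply: attained_bounded_pairs => //; [exact: closed_convex|exact: closed_convex|].
  by move=> d; exact: coercive_bound.
case=> [[/bws bX clAB]|]; first exact: attained_mink_sub_closed.
case=> [[/bws bX /convex_rconvex cA /convex_rconvex cB /closed_nclosed clAB]|].
  by apply: attained_convex_mink_sub => //; exact: mink_sub_convex.
case=> [[/bws bX [At [Ah [Bt [Bh [AE BE [cA cB] clAB]]]]]]|].
  rewrite {A}AE {B}BE in A_neq0 B_neq0 *.
  by apply: attained_mink_add => //; exact: weakly_seq_compactP.
case=> [[rX clA [At [F [Bt [AAt AtF BBt clP]]]]]|].
  have sB := linear_rsubspace BBt.1.
  apply: (attained_affine (bws rX) A_neq0 B_neq0 AAt BBt).
  exact: (proj_along_closed_sum rX.1 (bws rX) AtF sB (closed_nclosed clP)).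
case=> [[/bws bX clA [At AAt] [Bt BBt /finite_dim_span[ws BtE]]]|].
  apply: (attained_affine bX A_neq0 B_neq0 AAt BBt); rewrite BtE mink_add_span.
  apply: span_over_closed (linear_rsubspace AAt.1) _.
  exact: linear_part_nclosed clA AAt.
case=> [[/bws bX clA [At AAt [n [F [_ _ _ AtF] /has_dim_span[ws FE]]]]
    [Bt BBt]]|].
  have sA := linear_rsubspace AAt.1; have sB := linear_rsubspace BBt.1.
  apply: (attained_affine bX A_neq0 B_neq0 AAt BBt).
  (* [At + Bt] contains the closed subspace [At] of finite codimension, hence is closed whatever
     [Bt] is. *)
  apply: (@finite_codim_closed _ _ _ At _ ws) => //.
  - exact: linear_part_nclosed clA AAt.
  - by rewrite -mink_add_span -FE.
  - exact: mink_add_rsubspace.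
  - by move=> x Ax; exists x => //; exists 0; [exact: sB.1|rewrite addr0].
case=> [[Y [J [sY JX cA clB]]]|]; first exact: attained_weak_star sY JX cA clB.
case=> [[_ hX pA pB]|]; first exact: attained_polyhedral.
case=> [[hX clA [p _ BE]]|].
  by rewrite BE in B_neq0 *; exact: attained_voronoi_hilbert.
case=> [[hX [clA [L AL _]] [p _ BE]]|].
  have E : [set z | pdist z [set p] <= pdist z A]
      = [set z | rnorm (z - p) <= pdist z A].
    by apply/seteqP; split => z /=; rewrite pdist_set1.
  rewrite BE E in B_neq0 *; apply: attained_voronoi_hilbert => //.
  (* A closed hyperplane is a translate of a subspace, hence convex. *)
  apply: convex_weakly_seq_closed; first exact: closed_nclosed.
  have [sL [u ->]] := AL.
  have -> : mink_add [set u] L = [set x | L (x - u)].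
    apply/seteqP; split => [_ [_ -> [y Ly <-]]|x Lx] /=.
      by rewrite addrC addKr.
    by exists u => //; exists (x - u) => //; rewrite addrC subrK.
  exact: rconvex_shift (rsubspace_convex (linear_rsubspace sL)).
case=> [[/bws bX [C [D [AC BD /weakly_seq_compactP cC /weakly_seq_compactP cD]]]]|].
  exact: attained_gen_hypercylinder AC BD cC cD.
case=> [[fA fB]|]; first exact: attained_finite_dim_affine.
case=> [[fX /closed_nclosed clA /closed_nclosed clB bAB]|].
  by apply: attained_finite_dim => // d; exact: bounded_or_coercive_bound.
case=> [[fX clA [P [P0 bP BE]]]|[_ _ hX [pA pB]]]; last exact: attained_polyhedral.
by rewrite BE in B_neq0 *; exact: attained_voronoi_finite_dim.
Qed.
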